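(* Let $d\ge2$, $\alpha>1$, and let $\{X_{\mathbf k},\mathbf k\in\mathbb Z_+^d\}$ be independent, identically distributed random variables (distributed as $X$) in a sub-linear expectation space with $\mathbb E(X)=\mathbb E(-X)=0$, and partial sums $S_{\mathbf n}=\sum_{\mathbf k\le\mathbf n}X_{\mathbf k}$. If $$C_{\mathbb V}\Big\{\exp\big\{(\log^+|X|)^\alpha\big\}(\log^+|X|)^{d-1}\Big\}<\infty,$$ then $$\sum_{\mathbf n\in\mathbb Z_+^d}\exp\{(\log|\mathbf n|)^\alpha\}\frac{(\log|\mathbf n|)^{\alpha-1}}{|\mathbf n|^2}\,\mathbb V(|S_{\mathbf n}|>|\mathbf n|\varepsilon)<\infty\quad\text{for all }\varepsilon>1.$$
   Context: Setting: a regular, countably sub-additive sub-linear expectation space $(\Omega,\mathcal H,\mathbb E)$ ($\mathbb E$ monotone, constant-preserving, positively homogeneous, sub-additive on a class $\mathcal H$ closed under locally Lipschitz functions), represented as $\mathbb E(X)=\sup_{P\in\mathcal P}E_P(X)$; capacity $\mathbb V(A)=\sup_{P\in\mathcal P}P(A)$; Choquet integral $C_{\mathbb V}(X)=\int_0^\infty\mathbb V(X>x)dx+\int_{-\infty}^0(\mathbb V(X>x)-1)dx$. Independence in the sub-linear sense: $Y$ is independent of $(X_1,\dots,X_m)$ if $\mathbb E[\psi(X,Y)]=\mathbb E[\mathbb E[\psi(x,Y)]|_{x=X}]$ for all locally Lipschitz $\psi$, applied along an enumeration of the index set; identically distributed means $\mathbb E[\psi(X_{\mathbf k})]=\mathbb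 E[\psi(X)]$ for locally Lipschitz $\psi$. $\mathbb Z_+^d$ is the positive integer lattice with coordinatewise order: $\mathbf m\le\mathbf n$ iff $m_k\le n_k$ for all $k$; $|\mathbf n|=\prod_{k=1}^dn_k$. $\log$ denotes $\log^+=\max(\log,0)$. *)

(* Defs.v *)
From HB Require Import structures.
From mathcomp Require Import all_boot all_order all_algebra.
From mathcomp Require Import all_classical all_reals all_analysis.
Set Implicit Arguments. Unset Strict Implicit. Unset Printing Implicit Defensive.
Import Order.TTheory GRing.Theory Num.Theory.
Import numFieldNormedType.Exports.
Local Open Scope classical_set_scope.
Local Open Scope ring_scope.

Definition slE (dT : measure_display) (T : measurableType dT) (R : realType)
  (Pf : set (probability T R)) (X : T -> R) : \bar R :=
  ereal_sup [set (\int[mu]_x (X x)%:E)%E | mu in Pf].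

Definition capV (dT : measure_display) (T : measurableType dT) (R : realType)
  (Pf : set (probability T R)) (A : set T) : \bar R :=
  ereal_sup [set mu A | mu in Pf].

Definition choquetV (dT : measure_display) (T : measurableType dT) (R : realType)
  (Pf : set (probability T R)) (X : T -> R) : \bar R :=
  (\int[@lebesgue_measure R]_(x in `[0%R, +oo[%classic) capV Pf [set w | ((x : R) < X w)%R]
   + \int[@lebesgue_measure R]_(x in `]-oo, 0%R[%classic)
        (capV Pf [set w | ((x : R) < X w)%R] - 1))%E.

Definition locLip (R : realType) (n : nat) (phi : ('I_n -> R) -> R) : Prop :=
  exists (C : R) (m : nat), forall x y : 'I_n -> R,
    `|phi x - phi y| <= C * (1 + (\sum_(i < n) `|x i|) ^+ m
                              + (\sum_(i < n) `|y i|) ^+ m)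
                          * \sum_(i < n) `|x i - y i|.

Definition extend (R : Type) (n : nat) (x : 'I_n -> R) (y : R) : 'I_n.+1 -> R :=
  fun i => match unlift ord_max i with Some j => x j | None => y end.

(* A regular sub-linear expectation space (Omega, H, E) with E represented
   by the family Pf (E monotone, constant-preserving, positively homogeneous,
   sub-additive and countably sub-additive automatically by the representation). *)
Definition sl_space (dT : measure_display) (T : measurableType dT) (R : realType)
  (Pf : set (probability T R)) (H : set (T -> R)) : Prop :=
  [/\ Pf !=set0,
      (forall X, H X -> measurable_fun setT X),
      (forall (n : nat) (Xs : 'I_n -> T -> R) (phi : ('I_n -> R) -> R),
          (forall i, H (Xs i)) -> locLip phi -> H (fun w => phi (fun i => Xs i w)))
    &
      (forall Xn : nat -> T -> R, (forall n, H (Xn n)) ->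
         (forall n w, 0 <= Xn n.+1 w <= Xn n w) ->
         (forall w, (fun n => Xn n w) @ \oo --> 0%R) ->
         (fun n => slE Pf (Xn n)) @ \oo --> 0%E)].

Definition sl_indep (dT : measure_display) (T : measurableType dT) (R : realType)
  (Pf : set (probability T R))
  (n : nat) (Xs : 'I_n -> T -> R) (Y : T -> R) : Prop :=
  forall phi : ('I_n.+1 -> R) -> R, locLip phi ->
    let phibar := fun x : 'I_n -> R => slE Pf (fun w => `|phi (extend x (Y w))|) in
    (forall x, (phibar x < +oo)%E) ->
    (slE Pf (fun w => (`|fine (phibar (fun i => Xs i w))|)%R) < +oo)%E ->
    slE Pf (fun w => phi (extend (fun i => Xs i w) (Y w)))
    = slE Pf (fun w => fine (slE Pf (fun w' => phi (extend (fun i => Xs i w) (Y w'))))).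

Definition posidx (d : nat) : set {ffun 'I_d -> nat} :=
  [set k | forall i, (0 < k i)%N].

Definition lat_norm (d : nat) (n : {ffun 'I_d -> nat}) : nat := (\prod_(i < d) n i)%N.

Definition field_indep (dT : measure_display) (T : measurableType dT) (R : realType)
  (Pf : set (probability T R)) (d : nat)
  (X : {ffun 'I_d -> nat} -> T -> R) : Prop :=
  exists e : nat -> {ffun 'I_d -> nat},
    [/\ injective e, (forall m, @posidx d (e m)),
        (forall k, @posidx d k -> exists m, e m = k)
      & forall m : nat, sl_indep Pf (fun i : 'I_m => X (e i)) (X (e m))].

Definition ident_distr (dT : measure_display) (T : measurableType dT) (R : realType)
  (Pf : set (probability T R)) (X Y : T -> R) : Prop :=
  forall phi : ('I_1 -> R) -> R, locLip phi ->
    slE Pf (fun w => phi (fun _ => X w)) = slE Pf (fun w => phi (fun _ => Y w)).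

Definition psum (T : Type) (R : realType) (d : nat)
  (X : {ffun 'I_d -> nat} -> T -> R) (n : {ffun 'I_d -> nat}) (w : T) : R :=
  \sum_(f : {ffun 'I_d -> 'I_(\sum_(i < d) n i).+1}
          | [forall i, (0 < f i)%N && (f i <= n i)%N])
     X [ffun i => nat_of_ord (f i)] w.

Definition logp (R : realType) (x : R) : R := ln (Num.max x 1).

(* Main.v *)
(** Chernoff's bound with truncation at [y = c |n|], [1 < c < eps]. Write
    [L = ln |n|] and [t = lam L^alpha / y] with [lam < 1]. Since
    for [|n|] large
      [exp (t min (x, y)) <= 1 + t x + 2 t^2 x^2 + |n|^-2 exp ((log+ |x|)^alpha)],
    independence bounds the expectation of the product of the |n| truncated exponentials
    by a constant, so that
      [V (|S_n| > eps |n|) <= |n| V (|X| > |n|) + C exp (- (lam eps / c) L^alpha)],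
    where [lam eps / c > 1]: against the weights
    [w n] of the series, the second term is [O (|n|^-2)].
    For the first one, put [G x = exp ((log x)^alpha)]. Splitting off a largest
    coordinate [k] of [n], with [p] the product of the others, the weight
    [|n| w n] is at most a constant times [(G (p k) - G (p (k - 1))) / p]; telescoping
    in [k] and summing [1 / p] gives
      [\sum_(|n| <= j) |n| w n <= C G j (1 + log j)^(d-1)],
    and Abel summation compares the series with the Choquet integral. *)
Require Import Defs.
From HB Require Import structures.
From mathcomp Require Import all_boot all_order all_algebra.
From mathcomp Require Import all_classical all_reals all_analysis.
From mathcomp Require Import measurable_realfun.
From mathcomp Require Import ring lra.
Set Implicit Arguments.
Unset Strict Implicit.
Unset Printing Implicit Defensive.
Import Order.TTheory GRing.Theory Num.Theory.
Import numFieldNormedType.Exports.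
Local Open Scope classical_set_scope.
Local Open Scope ring_scope.

(** * The function exp ((log x)^alpha) *)

(** The bound [ln z <= z] at [z = b x / a] gives [x ^ a <= (a / b) ^ a * exp (b x)]. The maximum
    with 1 keeps [ln C] nonnegative for later use. *)
Lemma powR_le_expR (R : realType) (a b : R) : 0 < a -> 0 < b ->
  exists2 C, 1 <= C & forall x, 0 <= x -> x `^ a <= C * expR (b * x).
Proof.
move=> a0 b0; exists (Num.max 1 ((a / b) `^ a)); first by rewrite le_max lexx.
move=> x; rewrite le_eqVlt => /predU1P[<-|x0].
  by rewrite powR0 ?gt_eqF// mulr_ge0 ?expR_ge0// le_max ler01.
apply: (@le_trans _ _ ((a / b) `^ a * expR (b * x))); last first.
  by rewrite ler_wpM2r ?expR_ge0// le_max lexx orbT.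
have ab0 : 0 < a / b by rewrite divr_gt0.
rewrite /powR !gt_eqF// -expRD ler_expR -lerBlDl -mulrBr -ln_div ?posrE//.
have xab0 : 0 < x / (a / b) by rewrite divr_gt0.
have -> : b * x = a * (x / (a / b)) by field; rewrite !gt_eqF.
by rewrite ler_pM2l// ltW// ln_sublinear.
Qed.

Lemma ln_nat_ge0 (R : realType) (n : nat) : 0 <= ln (n%:R : R).
Proof. by case: n => [|n]; [rewrite ln0|rewrite ln_ge0// ler1n]. Qed.

Lemma ler_ln_nat (R : realType) (m n : nat) : (m <= n)%N -> ln (m%:R : R) <= ln n%:R.
Proof.
case: m => [|m] mn; first by rewrite (ln0 (lexx 0)) ln_nat_ge0.
by rewrite ler_ln ?posrE ?ltr0n ?ler_nat// (leq_trans _ mn).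
Qed.

(** This is [ln (1 + z) <= z] at [z = - 1 / (k + 2)]. *)
Lemma invr_le_lnS_sub (R : realType) (k : nat) :
  k.+2%:R^-1 <= ln k.+2%:R - ln k.+1%:R :> R.
Proof.
have -> : ln (k.+2%:R : R) - ln k.+1%:R = - ln (k.+1%:R / k.+2%:R).
  by rewrite ln_div ?posrE ?ltr0n// opprB.
have KE : k.+2%:R = k.+1%:R + 1 :> R by rewrite natr1.
have -> : k.+1%:R / k.+2%:R = 1 + - k.+2%:R^-1 :> R.
  by rewrite -[k.+1%:R](addrK 1) -KE mulrDl mulfV ?mulN1r ?gt_eqF.
by rewrite lerNr le_ln1Dx// ltrN2 invf_lt1// ltr1n.
Qed.

(** The function [G] of the overview at integers. As [ln 0 = 0], its value at 0 is 1 for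
    [alpha > 0], so monotonicity holds from 0 on. *)
Definition exp_lnpow (R : realType) (alpha : R) (n : nat) : R :=
  expR (ln n%:R `^ alpha).

Lemma exp_lnpow_ge1 (R : realType) (alpha : R) n : 1 <= exp_lnpow alpha n.
Proof. by rewrite /exp_lnpow -[leLHS]expR0 ler_expR powR_ge0. Qed.

Lemma ler_exp_lnpow (R : realType) (alpha : R) m n : 0 <= alpha ->
  (m <= n)%N -> exp_lnpow alpha m <= exp_lnpow alpha n.
Proof.
move=> a0 mn; rewrite ler_expR ge0_ler_powR ?nnegrE ?ln_nat_ge0//.
exact: ler_ln_nat.
Qed.

(* [L_u ^ alpha - L_v ^ alpha >= L_u ^ (alpha - 1) * (L_u - L_v)] with [u = p k],
   [v = p (k - 1)] and [L_u - L_v >= 1 / k]; the constant comes from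
   [L_u <= (d + 1) * ln k], so that [L_u ^ (alpha - 1) / k] is bounded. *)
Lemma exp_lnpow_increment (R : realType) (alpha : R) (d : nat) : 1 < alpha ->
  exists2 S, 0 <= S & forall p k, (0 < p)%N -> (0 < k)%N -> (p <= k ^ d)%N ->
    exp_lnpow alpha (p * k) * ln (p * k)%:R `^ (alpha - 1) <=
    S * k%:R * (exp_lnpow alpha (p * k) - exp_lnpow alpha (p * k.-1)).
Proof.
move=> a1; have a10 : 0 < alpha - 1 by rewrite subr_gt0.
have a0 : 0 < alpha by rewrite (lt_trans _ a1).
have [C C1 HC] := powR_le_expR a10 ltr01.
set D : R := d.+1%:R `^ (alpha - 1) * C.
have D0 : 0 <= D by rewrite mulr_ge0 ?powR_ge0// (le_trans ler01).
exists (1 + D); first by rewrite addr_ge0.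
move=> p [//|[|k]] p0 _ pk.
  (* For [k = 1] also [p = 1], and both sides vanish because [ln 1 = ln 0 = 0]. *)
  move: pk; rewrite exp1n => p1; have -> : p = 1%N by apply/eqP; rewrite eqn_leq p1 p0.
  by rewrite /exp_lnpow !muln1 muln0 ln1 (ln0 (lexx 0)) powR0 ?gt_eqF//
    powR0 ?gt_eqF// subrr !mulr0.
set K := k.+2; rewrite -[K.-1]/k.+1.
set u : R := ln (p * K)%:R; set v : R := ln (p * k.+1)%:R.
have v0 : 0 <= v by exact: ln_nat_ge0.
have uv : v <= u by apply: ler_ln_nat; rewrite leq_mul2l leqnSn orbT.
have u0 : 0 <= u by exact: le_trans uv.
have K0 : (0 : R) < K%:R by rewrite ltr0n.
have uvk : K%:R^-1 <= u - v.
  rewrite /u /v !natrM !lnM ?posrE ?ltr0n//.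
  by rewrite opprD addrACA subrr add0r invr_le_lnS_sub.
set s := u `^ (alpha - 1) / K%:R.
have s0 : 0 <= s by rewrite divr_ge0 ?powR_ge0// ltW.
have sD : s <= D.
  have ulnk : u <= d.+1%:R * ln K%:R.
    rewrite mulr_natl -lnXn// -natrX; apply: ler_ln_nat.
    by rewrite expnSr leq_mul2r pk orbT.
  rewrite /s ler_pdivrMr//.
  apply: (@le_trans _ _ ((d.+1%:R * ln K%:R) `^ (alpha - 1))).
    rewrite ge0_ler_powR ?nnegrE ?(ltW a10)//.
    by rewrite mulr_ge0 ?ln_nat_ge0.
  rewrite powRM ?ln_nat_ge0// /D -mulrA ler_wpM2l ?powR_ge0//.
  apply: le_trans (HC _ (ln_nat_ge0 _ _)) _.
  by rewrite mul1r lnK ?posrE.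
have sab : s <= u `^ alpha - v `^ alpha.
  rewrite -(mulr_powRB1 u0 a0) -(mulr_powRB1 v0 a0).
  apply: (@le_trans _ _ (u `^ (alpha - 1) * (u - v))).
    by rewrite /s ler_wpM2l ?powR_ge0.
  rewrite mulrBr (mulrC _ u) (mulrC _ v) lerD2l lerN2 ler_wpM2l//.
  by rewrite ge0_ler_powR ?nnegrE ?(ltW a10).
rewrite /exp_lnpow -/u -/v.
(* As [s] is at most the gap [u ^ alpha - v ^ alpha], the ratio [E] of the two exponentials is at
   most [1 / (1 + s)]. *)
have key : expR (u `^ alpha) * s <= (1 + s) * (expR (u `^ alpha) - expR (v `^ alpha)).
  have -> : expR (v `^ alpha) = expR (u `^ alpha) * expR (- (u `^ alpha - v `^ alpha)).
    by rewrite -expRD; congr expR; ring.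
  set E := expR (- _).
  rewrite [leRHS](_ : _ = expR (u `^ alpha) * ((1 + s) * (1 - E))); last by ring.
  rewrite ler_wpM2l ?expR_ge0//.
  suff : (1 + s) * E <= 1 by lra.
  rewrite /E expRN ler_pdivrMr ?expR_gt0// mul1r.
  by rewrite (le_trans _ (expR_ge1Dx _))// lerD2l.
have -> : u `^ (alpha - 1) = s * K%:R by rewrite /s divfK// gt_eqF.
rewrite mulrA (mulrAC (1 + D)) ler_pM2r//.
apply: le_trans key _; rewrite ler_wpM2r ?lerD2l// subr_ge0 ler_expR.
by rewrite ge0_ler_powR ?nnegrE// ltW.
Qed.

Lemma ln_nat_eventually_ge (R : realType) (K : R) :
  exists N : nat, forall n, (N <= n)%N -> K <= ln n%:R.
Proof.
exists (Num.bound (expR K)) => n Nn.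
have := archi_boundP (expR_ge0 K); rewrite -(ler_nat R) in Nn.
move=> /ltW/le_trans/(_ Nn) Kn.
by rewrite -[leLHS]expRK ler_ln ?posrE ?expR_gt0// (lt_le_trans (expR_gt0 K)).
Qed.

(** From [exp u <= 1 / (1 - u)] and [(1 + u + 2 u^2) (1 - u) = 1 + u^2 (1 - 2 u)]. *)
Lemma expR_le_quadratic (R : realType) (u : R) : u <= 2^-1 ->
  expR u <= 1 + u + 2 * u ^+ 2.
Proof.
move=> u2; have u1 : 0 < 1 - u by lra.
have : expR u <= (1 - u)^-1.
  by rewrite -[u]opprK expRN opprK lef_pV2 ?posrE ?expR_gt0// expR_ge1Dx.
move=> /le_trans; apply; rewrite -[leLHS]mul1r ler_pdivrMr//.
have : 0 <= u ^+ 2 * (1 - 2 * u) by rewrite mulr_ge0 ?sqr_ge0//; lra.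
lra.
Qed.

(* With [theta < 1], [lam < theta ^ alpha]: as [L ^ alpha] is sub-exponential,
   [x > 1 / (2 t)] forces [ln x >= theta * L]. *)
Lemma truncation_asymptotics (R : realType) (alpha lam c : R) :
  1 < alpha -> 0 < lam -> lam < 1 -> 1 <= c ->
  exists N : nat, forall n : nat, (N <= n)%N ->
    let L : R := ln n%:R in let y : R := c * n%:R in
    let t : R := lam * L `^ alpha / y in
    [/\ (0 < n)%N, 0 < t, n%:R * t ^+ 2 <= 1 &
      forall x, 2^-1 < t * x ->
        1 <= ln x /\ t * y + 2 * L <= ln x `^ alpha].
Proof.
move=> a1 lam0 lam1 c1.
have a10 : 0 < alpha - 1 by rewrite subr_gt0.
have a0 : 0 < alpha by rewrite (lt_trans _ a1).
(* This choice makes [theta ^ alpha] the square root of [lam], which exceeds [lam]. *)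
pose theta := lam `^ (2 * alpha)^-1.
have th0 : 0 < theta by rewrite powR_gt0.
have th1 : theta < 1.
  by rewrite -(powRr0 lam) /theta /powR gt_eqF// ltr_expR mul0r
    pmulr_rlt0 ?invr_gt0 ?mulr_gt0// ln_lt0// lam0.
have tha : lam < theta `^ alpha.
  rewrite /theta -powRrM invfM divfK ?gt_eqF// -[ltLHS]powRr1 ?ltW//.
  rewrite /powR gt_eqF// ltr_expR mul1r -[ltLHS]mul1r ltr_nM2r; last by rewrite ln_lt0// lam0.
  by lra.
(* Of the exponent [L], one share [b * L] pays for [L ^ alpha <= C exp (b L)] and another for the
   factor [2 C]; [theta * L] remains. *)
pose b := (1 - theta) / 2; have b0 : 0 < b by rewrite /b; lra.
have [C C1 HC] := powR_le_expR a0 b0.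
have a20 : 0 < 2 * alpha by rewrite mulr_gt0.
have h0 : 0 < 2^-1 :> R by rewrite invr_gt0.
have [C' C'1 HC'] := powR_le_expR a20 h0.
pose K1 := 2 / (theta `^ alpha - lam).
have K10 : 0 < K1 by rewrite divr_gt0 ?subr_gt0.
(* The four summands make [L] large enough, in turn, to absorb [2 C], to get [(L ^ alpha)^2 <= n],
   to get [(theta ^ alpha - lam) L ^ alpha >= 2 L], and to get [theta * L >= 1]. *)
have [N HN] := @ln_nat_eventually_ge R
  (ln (2 * C) / b + 2 * ln C' + K1 `^ (alpha - 1)^-1 + theta^-1).
exists (maxn N 1) => n; rewrite geq_max => /andP[/HN Ln n0] L y t.
have lnC : 0 <= ln (2 * C) by rewrite ln_ge0//; lra.
have lnC' : 0 <= ln C' by rewrite ln_ge0.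
have thV : 0 < theta^-1 by rewrite invr_gt0.
have lnCb : 0 <= ln (2 * C) / b by rewrite divr_ge0// ltW.
have K1p := powR_ge0 K1 (alpha - 1)^-1.
have [L1 L2 L3 L4] : [/\ ln (2 * C) / b <= L, 2 * ln C' <= L,
    K1 `^ (alpha - 1)^-1 <= L & theta^-1 <= L].
  by rewrite /L; split; lra.
have L0 : 0 < L by exact: lt_le_trans L4.
have n0R : (0 : R) < n%:R by rewrite ltr0n.
have y0 : 0 < y by rewrite mulr_gt0// (lt_le_trans _ c1).
have t0 : 0 < t by rewrite /t divr_gt0// mulr_gt0// powR_gt0.
have eL : expR L = n%:R by rewrite lnK ?posrE.
split => //.
  have tn : t <= L `^ alpha / n%:R.
    rewrite /t ler_pdivrMr// /y mulrACA mulVf ?gt_eqF// mulr1.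
    by rewrite [leLHS]mulrC ler_wpM2l ?powR_ge0//; lra.
  have L2a : (L `^ alpha) ^+ 2 <= n%:R.
    rewrite -powR_mulrn ?powR_ge0// -powRrM mulrC (le_trans (HC' _ (ltW L0)))//.
    rewrite -eL -[C']lnK ?posrE ?(lt_le_trans ltr01)// -expRD ler_expR; lra.
  rewrite (le_trans (y := n%:R * (L `^ alpha / n%:R) ^+ 2))//.
    rewrite ler_pM2l// ler_pXn2r ?nnegrE ?(ltW t0)//.
    by rewrite divr_ge0 ?powR_ge0// ltW.
  have -> : n%:R * (L `^ alpha / n%:R) ^+ 2 = (L `^ alpha) ^+ 2 / n%:R.
    by field; rewrite gt_eqF.
  by rewrite ler_pdivrMr// mul1r.
move=> x tx.
have x0 : 0 < x by rewrite -(pmulr_rgt0 x t0) (lt_trans _ tx).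
have xn : n%:R <= 2 * L `^ alpha * x.
  move: tx; rewrite /t mulrAC ltr_pdivlMr// => /ltW.
  have : n%:R <= y by rewrite /y ler_peMl// ltW.
  have : lam * (L `^ alpha * x) <= L `^ alpha * x.
    by rewrite ler_piMl ?mulr_ge0 ?powR_ge0// ltW.
  by rewrite !mulrA => h1 h2 h3; nra.
have lnx : theta * L <= ln x.
  have : L <= ln (2 * C) + b * L + ln x.
    have p0 : 0 < 2 * C * expR (b * L) * x by rewrite !mulr_gt0 ?expR_gt0//; lra.
    have nx : n%:R <= 2 * C * expR (b * L) * x.
      rewrite (le_trans xn)// ler_pM2r// -mulrA ler_pM2l//; exact/HC/ltW.
    have e0 := expR_gt0 (b * L); have C20 : 0 < 2 * C by lra.
    have C2e0 : 0 < 2 * C * expR (b * L) by exact: mulr_gt0.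
    rewrite -ler_ln ?posrE// in nx.
    by rewrite (le_trans nx)// lnM ?posrE// lnM ?posrE// expRK.
  have : ln (2 * C) <= b * L by rewrite (mulrC b) -ler_pdivrMr.
  have : b * L * 2 = L - theta * L by rewrite /b; field.
  lra.
have thL1 : 1 <= theta * L by rewrite mulrC -ler_pdivrMr// div1r.
split; first exact: le_trans lnx.
apply: (@le_trans _ _ ((theta * L) `^ alpha)); last first.
  by rewrite ge0_ler_powR ?nnegrE ?(ltW a0)// ?(le_trans _ lnx)// (le_trans ler01).
rewrite /t divfK ?gt_eqF// powRM ?(ltW th0) ?(ltW L0)//.
rewrite -lerBrDl -mulrBl -(mulr_powRB1 (ltW L0) a0) mulrCA mulrC ler_wpM2l ?(ltW L0)//.
rewrite mulrC -ler_pdivrMr ?subr_gt0// -/K1.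
have -> : K1 = (K1 `^ (alpha - 1)^-1) `^ (alpha - 1).
  by rewrite -powRrM mulVf ?gt_eqF// powRr1// ltW.
by rewrite ge0_ler_powR ?nnegrE ?(ltW a10)// ltW.
Qed.

(** * The moment weight and the truncated exponential *)

Definition exp_log_weight (R : realType) (alpha : R) (d : nat) (z : R) : R :=
  expR (logp z `^ alpha) * logp z ^+ d.-1.

Lemma logp_ge0 (R : realType) (z : R) : 0 <= logp z.
Proof. by rewrite /logp ln_ge0// le_max lexx orbT. Qed.

Lemma ler_logp (R : realType) (x y : R) : x <= y -> logp x <= logp y.
Proof.
move=> xy; rewrite /logp ler_ln ?posrE ?lt_max ?ltr01 ?orbT//.
by rewrite ge_max !le_max xy lexx orbT.
Qed.

Lemma exp_log_weight_ge0 (R : realType) (alpha : R) d z :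
  0 <= exp_log_weight alpha d z.
Proof. by rewrite mulr_ge0 ?expR_ge0 ?exprn_ge0 ?logp_ge0. Qed.

Lemma ler_exp_log_weight (R : realType) (alpha : R) d (x y : R) :
  0 <= alpha -> x <= y -> exp_log_weight alpha d x <= exp_log_weight alpha d y.
Proof.
move=> a0 /ler_logp xy.
have x0 := logp_ge0 x; have y0 := logp_ge0 y.
have exy : expR (logp x `^ alpha) <= expR (logp y `^ alpha).
  by rewrite ler_expR ge0_ler_powR.
have pxy : logp x ^+ d.-1 <= logp y ^+ d.-1 by rewrite lerXn2r.
exact: ler_pM (expR_ge0 _) (exprn_ge0 _ x0) exy pxy.
Qed.

(** Strictness comes from the logarithmic factor, whose exponent [d - 1] is positive. It carries the
    strict event [|X| > m] over to a strict event for the weight of [|X|]. *)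
Lemma exp_log_weight_lt (R : realType) (alpha : R) d (x y : R) :
  1 < alpha -> (2 <= d)%N -> 1 <= x -> x < y ->
  exp_log_weight alpha d x < exp_log_weight alpha d y.
Proof.
move=> a1 d2 x1 xy; have y1 : 1 < y by exact: le_lt_trans xy.
have lxy : logp x < logp y.
  by rewrite /logp !max_l ?(ltW y1)// ltr_ln ?posrE// (lt_le_trans ltr01)// ltW.
apply: (@le_lt_trans _ _ (expR (logp y `^ alpha) * logp x ^+ d.-1)).
  apply: ler_wpM2r; first exact/exprn_ge0/logp_ge0.
  have a0 : 0 <= alpha by rewrite (le_trans ler01)// ltW.
  by rewrite ler_expR ge0_ler_powR ?nnegrE ?logp_ge0// ltW.
rewrite ltr_pM2l ?expR_gt0// ltr_pXn2r ?nnegrE ?logp_ge0//.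
by rewrite -subn1 subn_gt0.
Qed.

(** Once [ln |x| >= 2 ^ (1 / (alpha - 1))], one has [(ln |x|) ^ alpha >= 2 ln |x|], the logarithm of
    [x^2]; smaller [x] are absorbed in [C]. Hence the hypothesis controls second moments. *)
Lemma sqr_le_exp_log_weight (R : realType) (alpha : R) d : 1 < alpha ->
  exists2 C, 0 <= C & forall x : R, x ^+ 2 <= C + exp_log_weight alpha d `|x|.
Proof.
move=> a1; have a10 : 0 < alpha - 1 by rewrite subr_gt0.
have a0 : 0 < alpha by rewrite (lt_trans _ a1).
pose K : R := Num.max 1 (2 `^ (alpha - 1)^-1).
have K1 : 1 <= K by rewrite le_max lexx.
exists (expR K ^+ 2); first by rewrite exprn_ge0 ?expR_ge0.
move=> x; rewrite -real_normK ?num_real//.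
have [xK|xK] := leP `|x| (expR K).
  rewrite -[leLHS]addr0 lerD ?exp_log_weight_ge0//.
  by rewrite ler_pXn2r ?nnegrE ?expR_ge0.
have x1 : 1 < `|x|.
  by rewrite (lt_trans _ xK)// expR_gt1 (lt_le_trans ltr01).
have x0 : 0 < `|x| by exact: lt_trans x1.
have LK : K <= ln `|x| by rewrite -[leLHS]expRK ler_ln ?posrE ?expR_gt0// ltW.
rewrite ler_wpDl ?exprn_ge0 ?expR_ge0//.
rewrite /exp_log_weight /logp max_l ?(ltW x1)//.
have L1 : 1 <= ln `|x| by exact: le_trans LK.
have L0 : 0 <= ln `|x| by exact: le_trans L1.
rewrite -[leLHS]mulr1 ler_pM ?exprn_ge0 ?exprn_ege1//.
rewrite -[in leLHS](@lnK _ `|x|) ?posrE// -expRM_natl ler_expR.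
rewrite -(mulr_powRB1 L0 a0) mulrC ler_wpM2l//.
have -> : 2 = (2 `^ (alpha - 1)^-1) `^ (alpha - 1) :> R.
  by rewrite -powRrM mulVf ?gt_eqF// powRr1.
rewrite ge0_ler_powR ?nnegrE ?(ltW a10) ?powR_ge0//.
by rewrite (le_trans _ LK)// le_max lexx orbT.
Qed.

(** Split at [t x = 1/2]. Below, the quadratic bound for [exp] applies; above, the truncated
    exponential is at most [exp (t y)], and [t y + 2 ln n <= (ln x) ^ alpha]. *)
Lemma expR_truncation_le (R : realType) (alpha lam c : R) (d : nat) :
  1 < alpha -> 0 < lam -> lam < 1 -> 1 <= c ->
  exists N : nat, forall n : nat, (N <= n)%N ->
    let y : R := c * n%:R in let t : R := lam * ln n%:R `^ alpha / y in
    [/\ (0 < n)%N, 0 < t, n%:R * t ^+ 2 <= 1 &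
      forall x, expR (t * Num.min x y) <=
        1 + t * x + (2 * t ^+ 2) * x ^+ 2
        + n%:R ^- 2 * exp_log_weight alpha d `|x|].
Proof.
move=> a1 lam0 lam1 c1.
have [N HN] := @truncation_asymptotics R alpha lam c a1 lam0 lam1 c1.
exists N => n /HN[]; set L := ln _; set y := c * _; set t := _ / y => n0 t0 nt H.
split => // x; have n0R : (0 : R) < n%:R by rewrite ltr0n.
have W0 : 0 <= n%:R ^- 2 * exp_log_weight alpha d `|x|.
  by rewrite mulr_ge0 ?exp_log_weight_ge0// invr_ge0 exprn_ge0.
have [tx|tx] := leP (t * x) 2^-1.
  rewrite ler_wpDr//; apply: (@le_trans _ _ (expR (t * x))).
    by rewrite ler_expR ler_pM2l// ge_min lexx.
  by rewrite (le_trans (expR_le_quadratic tx))// exprMn mulrA.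
have [L1 Ht] := H _ tx.
have x0 : 0 < x by rewrite -(pmulr_rgt0 x t0) (lt_trans _ tx).
have P0 : 0 <= 1 + t * x + (2 * t ^+ 2) * x ^+ 2.
  have := mulr_gt0 t0 x0; have := mulr_ge0 (sqr_ge0 t) (sqr_ge0 x); lra.
rewrite ler_wpDl//.
have x1 : 1 <= x by rewrite leNgt; apply/negP => x1; have := ln_lt0 (introT andP (conj x0 x1)); lra.
rewrite /exp_log_weight /logp (gtr0_norm x0) max_l//.
apply: (@le_trans _ _ (expR (t * y))); first by rewrite ler_expR ler_pM2l// ge_min lexx orbT.
rewrite ler_pdivlMl ?exprn_gt0//.
apply: (@le_trans _ _ (expR (ln x `^ alpha))); last by rewrite ler_peMr ?expR_ge0 ?exprn_ege1.
have -> : n%:R = expR L :> R by rewrite lnK ?posrE.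
by rewrite -expRM_natl -expRD ler_expR addrC.
Qed.

(** * Counting lattice points *)

(** The shift by one turns ['I_M] into the coordinates from 1 to [M], so that sums over boxes of the
    positive lattice range over a finite type. *)
Definition box_pt (d M : nat) (g : {ffun 'I_d -> 'I_M}) : {ffun 'I_d -> nat} :=
  [ffun i => (g i).+1].

Lemma lat_norm_box_pt d M (g : {ffun 'I_d -> 'I_M}) :
  lat_norm (box_pt g) = (\prod_(i < d) (g i).+1)%N.
Proof. by apply: eq_bigr => i _; rewrite ffunE. Qed.

Lemma lat_norm_gt0 d (n : {ffun 'I_d -> nat}) : @posidx d n -> (0 < lat_norm n)%N.
Proof. by move=> n0; rewrite prodn_gt0. Qed.

Lemma posidx_box_pt d M (g : {ffun 'I_d -> 'I_M}) : @posidx d (box_pt g).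
Proof. by move=> i; rewrite ffunE. Qed.

Lemma box_pt_inj d M : injective (@box_pt d M).
Proof.
move=> g g' /ffunP gg'; apply/ffunP => i; apply: val_inj.
by have := gg' i; rewrite !ffunE => -[].
Qed.

(** A finite set of positive lattice points lies in some box, and the other points of the box
    contribute nonnegative terms. *)
Lemma esum_posidx_le (R : realType) (d : nat) (a : {ffun 'I_d -> nat} -> \bar R)
  (B : \bar R) : (forall n, @posidx d n -> 0 <= a n)%E ->
  (forall M, \sum_(g : {ffun 'I_d -> 'I_M}) a (box_pt g) <= B)%E ->
  (\esum_(n in @posidx d) a n <= B)%E.
Proof.
move=> a0 aB; apply: ge_ereal_sup => _ [A [finA AS] <-].
rewrite fsbig_finite//=.
set sA : seq {ffun 'I_d -> nat} := finmap.enum_fset (fset_set A).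
have memA x : x \in sA -> A x.
  by move=> xA; have := in_fset_set finA x; rewrite [LHS]xA => /esym/set_mem.
pose M := (\max_(x <- sA) \max_(i < d) x i)%N.
apply: le_trans (aB M.+1).
have AM x i : x \in sA -> (x i <= M)%N.
  move=> xA; apply: (@leq_trans (\max_(i < d) x i)%N).
    by rewrite (bigD1 i)//= leq_maxl.
  by rewrite /M (big_rem x)//= leq_maxl.
pose s := [seq @box_pt d M.+1 g | g <- index_enum _ & box_pt g \in sA].
have -> : (\sum_(x <- sA) a x = \sum_(x <- s) a x)%E.
  apply: perm_big; apply: uniq_perm; first exact: finmap.fset_uniq.
    by rewrite map_inj_uniq ?filter_uniq ?index_enum_uniq//; exact: box_pt_inj.
  move=> x; apply/idP/mapP => [xA|[g]]; last by rewrite mem_filter => /andP[gA _] ->.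
  have xS : forall i, (0 < x i)%N by exact: (AS _ (memA _ xA)).
  have xE : x = box_pt [ffun i => @inord M (x i).-1].
    apply/ffunP => i; rewrite !ffunE inordK ?prednK ?xS//.
    by rewrite (leq_trans (AM _ i xA)).
  by eexists; last exact: xE; rewrite mem_filter -xE xA mem_index_enum.
rewrite /s big_map big_filter [leRHS](bigID (fun g => box_pt g \in sA))/=.
rewrite leeDl// sume_ge0// => g _; apply: a0; exact: posidx_box_pt.
Qed.

(** Induction needs the stronger bound [2 - 1 / M] for [M >= 1]. *)
Lemma sum_inv_sqr_le2 (R : realType) (M : nat) :
  \sum_(k < M) k.+1%:R ^- 2 <= 2 :> R.
Proof.
case: M => [|M]; first by rewrite big_ord0.
suff : \sum_(k < M.+1) k.+1%:R ^- 2 <= 2 - M.+1%:R^-1 :> R.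
  by move=> /le_trans; apply; rewrite gerBl invr_ge0.
elim: M => [|M IH]; first by rewrite big_ord_recr big_ord0/= expr1n invr1; lra.
rewrite big_ord_recr/=; apply: le_trans (lerD IH (lexx _)) _.
have m0 : (0 : R) < M.+1%:R by rewrite ltr0n.
have -> : M.+2%:R = M.+1%:R + 1 :> R by rewrite natr1.
move: m0; set m := M.+1%:R => m0; rewrite -addrA lerD2l -subr_ge0.
have -> : - (m + 1)^-1 - (- m^-1 + (m + 1) ^- 2) = (m * (m + 1) ^+ 2)^-1.
  by field; rewrite !gt_eqF// addr_gt0.
by rewrite invr_ge0 mulr_ge0 ?exprn_ge0 ?ltW ?addr_gt0.
Qed.

(** The summand is a product over coordinates, so the sum factors into [d] one-dimensional sums. *)
Lemma sum_lat_norm_inv_sqr (R : realType) (d M : nat) :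
  \sum_(g : {ffun 'I_d -> 'I_M}) (lat_norm (box_pt g))%:R ^- 2 <= 2 ^+ d :> R.
Proof.
under eq_bigr do rewrite lat_norm_box_pt natr_prod -prodrXl -prodfV.
rewrite -(bigA_distr_bigA (fun _ (k : 'I_M) => k.+1%:R ^- 2 : R)).
rewrite -[d in leRHS]card_ord -prodr_const; apply: ler_prod => i _.
by rewrite sum_inv_sqr_le2 andbT sumr_ge0// => k _; rewrite invr_ge0 exprn_ge0.
Qed.

(** The induction on [M] proves [1 + ln (minn M j)]: each further term below [j] is at most an
    increment of [ln]. *)
Lemma harmonic_le_ln (R : realType) (M j : nat) :
  \sum_(k < M | (k < j)%N) k.+1%:R^-1 <= 1 + ln j%:R :> R.
Proof.
apply: (@le_trans _ _ (1 + ln (minn M j)%:R)); last first.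
  by rewrite lerD2l ler_ln_nat// geq_minr.
elim: M => [|M IH]; first by rewrite big_ord0 addr_ge0 ?ln_nat_ge0.
rewrite big_mkcond big_ord_recr -big_mkcond/=.
case: ltnP => [Mj|jM]; last first.
  rewrite addr0 (le_trans IH)// lerD2l ler_ln_nat//.
  by rewrite leq_min geq_minr andbT geq_min leqnSn.
rewrite (minn_idPl Mj); case: M => [|M] in IH Mj *.
  by rewrite big_ord0 add0r invr1 ln1 addr0.
rewrite (minn_idPl (ltnW Mj)) in IH.
by rewrite (le_trans (lerD IH (invr_le_lnS_sub R M)))// -addrA subrKC.
Qed.

Lemma telescope_le (R : realType) (G : nat -> R) (p j M : nat) :
  (forall n, 0 <= G n) -> {homo G : m n / (m <= n)%N >-> m <= n} ->
  \sum_(k < M | (p * k.+1 <= j)%N) (G (p * k.+1)%N - G (p * k)%N) <= G j.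
Proof.
move=> G0 Gh; apply: (@le_trans _ _ (G (minn (p * M) j))); last exact/Gh/geq_minr.
elim: M => [|M IH]; first by rewrite big_ord0.
rewrite big_mkcond big_ord_recr -big_mkcond/=.
case: leqP => [Mj|jM]; last first.
  by rewrite addr0 (le_trans IH)// Gh// geq_minr.
have Mj' : (p * M <= j)%N by rewrite (leq_trans _ Mj)// leq_mul2l leqnSn orbT.
by rewrite (minn_idPl Mj') in IH; rewrite (le_trans (lerD IH (lexx _)))// subrKC.
Qed.

(** The product [p] of the overview when the coordinate [i0] is split off. *)
Definition cofiber_norm (d M : nat) (i0 : 'I_d) (g : {ffun 'I_d -> 'I_M}) : nat :=
  (\prod_(i < d | i != i0) (g i).+1)%N.

(** Group the points into lines in direction [i0]. Telescoping along a line leaves [G j / p], and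
    the sum of [1 / p] over the lines factors into [d - 1] harmonic sums. *)
Lemma sum_cofiber_le (R : realType) (d M j : nat) (i0 : 'I_d) (G : nat -> R) :
  (forall n, 0 <= G n) -> {homo G : m n / (m <= n)%N >-> m <= n} ->
  \sum_(g : {ffun 'I_d -> 'I_M} | (lat_norm (box_pt g) <= j)%N)
    (cofiber_norm i0 g)%:R^-1 *
      (G (cofiber_norm i0 g * (g i0).+1)%N - G (cofiber_norm i0 g * g i0)%N)
  <= G j * (1 + ln j%:R) ^+ d.-1.
Proof.
move=> G0 Gh; have ln0 := ln_nat_ge0 R j.
have B0 : 0 <= G j * (1 + ln j%:R) ^+ d.-1 by rewrite mulr_ge0// exprn_ge0// addr_ge0.
case: M => [|M]; first by rewrite big1// => g; case: (g i0).
pose upd (r : {ffun 'I_d -> 'I_M.+1}) k : {ffun 'I_d -> 'I_M.+1} :=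
  [ffun i => if i == i0 then k else r i].
(* Each line is represented by its point with [i0]-th entry [ord0]. The other entries stay below
   [j], since no coordinate exceeds the norm. *)
pose Q (i : 'I_d) := [pred k : 'I_M.+1 | if i == i0 then k == ord0 else (k < j)%N].
have cofE r k : cofiber_norm i0 (upd r k) = cofiber_norm i0 r.
  by apply: eq_bigr => i /negbTE ii0; rewrite ffunE ii0.
have normE (g : {ffun 'I_d -> 'I_M.+1}) : lat_norm (box_pt g) = (cofiber_norm i0 g * (g i0).+1)%N.
  by rewrite lat_norm_box_pt (bigD1 i0)//= mulnC.
have leqn (g : {ffun 'I_d -> 'I_M.+1}) i : ((g i).+1 <= lat_norm (@box_pt d M.+1 g))%N.
  by rewrite lat_norm_box_pt (bigD1 i)//= leq_pmulr// prodn_gt0.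
rewrite (partition_big (upd ^~ ord0) (mem (family Q)))/=; last first.
  move=> g gj; apply/familyP => i; rewrite ffunE inE/= ; case: eqP => // _.
  exact: leq_trans (leqn g i) gj.
apply: (@le_trans _ _ (\sum_(r in family Q) (cofiber_norm i0 r)%:R^-1 * G j)).
  apply: ler_sum => r rQ.
  have ri0 : r i0 = ord0 by move/familyP: rQ => /(_ i0); rewrite inE/= eqxx => /eqP.
  rewrite (reindex_onto (upd r) (fun g => g i0))/=; last first.
    move=> g /andP[_ /eqP <-]; apply/ffunP => i; rewrite !ffunE.
    by case: eqP => [->|].
  under eq_bigr do rewrite cofE.
  rewrite -big_distrr/= ler_wpM2l ?invr_ge0//.
  apply: le_trans (@telescope_le R G (cofiber_norm i0 r) j M.+1 G0 Gh).
  rewrite [leLHS]big_mkcond [leRHS]big_mkcond/=; apply: ler_sum => k _.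
  rewrite normE cofE ffunE eqxx.
  case: leqP => _ /=; last by [].
  by case: ifP => // _; rewrite subr_ge0 Gh// leq_mul2l leqnSn orbT.
rewrite -big_distrl/= mulrC ler_wpM2l//.
pose F (i : 'I_d) (k : 'I_M.+1) : R := if i == i0 then 1 else k.+1%:R^-1.
rewrite (eq_bigr (fun r : {ffun 'I_d -> 'I_M.+1} => \prod_i F i (r i))); last first.
  move=> r _; rewrite /F (bigD1 i0)//= eqxx mul1r /cofiber_norm natr_prod -prodfV.
  by apply: eq_bigr => i /negbTE ->.
rewrite -(bigA_distr_big_dep _ F) (bigD1 i0)//=.
rewrite /F eqxx big_pred1_eq mul1r.
have -> : d.-1 = #|[pred i | i != i0]| by rewrite cardC1 card_ord.
rewrite -prodr_const; apply: ler_prod => i /= ii0; rewrite (negbTE ii0).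
by rewrite harmonic_le_ln andbT sumr_ge0// => k _; rewrite invr_ge0.
Qed.

(* Splitting off a largest coordinate [k] makes the product [p] of the others at
   most [k ^ (d - 1)], so the increment bound applies along the fibre. *)
Lemma sum_lattice_le (R : realType) (alpha : R) (d : nat) : 1 < alpha -> (0 < d)%N ->
  exists2 C, 0 <= C & forall M j : nat,
    \sum_(g : {ffun 'I_d -> 'I_M} | (lat_norm (box_pt g) <= j)%N)
      (exp_lnpow alpha (lat_norm (box_pt g)) * ln (lat_norm (box_pt g))%:R `^ (alpha - 1)
        / (lat_norm (box_pt g))%:R)
    <= C * (exp_lnpow alpha j * (1 + ln j%:R) ^+ d.-1).
Proof.
move=> a1 d0; have [S S0 HS] := @exp_lnpow_increment R alpha d.-1 a1.
have G0 n : 0 <= exp_lnpow alpha n by rewrite (le_trans ler01)// exp_lnpow_ge1.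
have Gh : {homo exp_lnpow alpha : m n / (m <= n)%N >-> m <= n}.
  by move=> m n; apply: ler_exp_lnpow; rewrite ltW// (lt_trans _ a1).
exists (d%:R * S) => [|M j]; first by rewrite mulr_ge0.
rewrite -mulrA -[d in d%:R]card_ord mulr_natl -sumr_const.
pose T i0 (g : {ffun 'I_d -> 'I_M}) := (cofiber_norm i0 g)%:R^-1 *
  (exp_lnpow alpha (cofiber_norm i0 g * (g i0).+1) - exp_lnpow alpha (cofiber_norm i0 g * g i0)).
have T0 i0 g : 0 <= T i0 g.
  by rewrite mulr_ge0 ?invr_ge0// subr_ge0 Gh// leq_mul2l leqnSn orbT.
(* Summing over all directions costs the factor [d] and lets every [g] use the direction of its own
   largest coordinate. *)
apply: (@le_trans _ _ (\sum_(i0 : 'I_d)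
  \sum_(g : {ffun 'I_d -> 'I_M} | (lat_norm (box_pt g) <= j)%N) S * T i0 g)); last first.
  by apply: ler_sum => i0 _; rewrite -big_distrr/= ler_wpM2l// sum_cofiber_le.
rewrite exchange_big/=; apply: ler_sum => g _.
have [i0 _ Hi0] := @arg_maxnP _ (Ordinal d0) xpredT (fun i => nat_of_ord (g i)) isT.
rewrite (bigD1 i0)//= ler_wpDr//; first by rewrite sumr_ge0// => i _; rewrite mulr_ge0.
have -> : lat_norm (box_pt g) = (cofiber_norm i0 g * (g i0).+1)%N.
  by rewrite lat_norm_box_pt (bigD1 i0)//= mulnC.
have p0 : (0 < cofiber_norm i0 g)%N by rewrite prodn_gt0.
have pk : (cofiber_norm i0 g <= (g i0).+1 ^ d.-1)%N.
  have -> : d.-1 = #|[pred i | i != i0]| by rewrite cardC1 card_ord.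
  by rewrite -prod_nat_const; apply: leq_prod => i _; exact: Hi0.
have /= := HS _ _ p0 (ltn0Sn (g i0)) pk.
rewrite /T; set p := cofiber_norm i0 g; set k := (g i0).+1; set A := _ - _.
rewrite natrM => H; rewrite ler_pdivrMr ?mulr_gt0 ?ltr0n//.
rewrite (le_trans H)// le_eqVlt; apply/orP; left; apply/eqP.
have p0R : (p%:R : R) != 0 by rewrite pnatr_eq0 -lt0n.
have H' (x y z w : R) : w != 0 -> x * y * z = x * (w^-1 * z) * (w * y) by move=> w0; field.
exact: H'.
Qed.

(** * Abel summation over the lattice *)

Lemma abel_sum_le (R : realType) (I : finType) (a : I -> R) (l : I -> nat)
  (B h : nat -> R) (N : nat) :
  (forall j, \sum_(i | (l i <= j)%N) a i <= B j) ->
  (forall m, 0 <= h m) -> (forall m, h m.+1 <= h m) ->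
  \sum_(i | (l i <= N)%N) a i * h (l i) <=
  B 0 * h 0 + \sum_(m < N) (B m.+1 - B m) * h m.+1.
Proof.
move=> aB h0 hm; pose A j := \sum_(i | (l i <= j)%N) a i.
(* The nonnegative slack [(B N - A N) * h N] makes the induction close; passing from [h N] to
   [h N.+1] in it uses that [h] is non-increasing. *)
suff : \sum_(i | (l i <= N)%N) a i * h (l i) + (B N - A N) * h N <=
    B 0 * h 0 + \sum_(m < N) (B m.+1 - B m) * h m.+1.
  by apply: le_trans; rewrite lerDl mulr_ge0// subr_ge0 aB.
elim: N => [|N IH].
  rewrite big_ord0 addr0 (eq_bigr (fun i => a i * h 0)) => [|i].
    by rewrite -big_distrl/= -mulrDl addrC subrK.
  by rewrite leqn0 => /eqP ->.
have splitS (F : I -> R) : \sum_(i | (l i <= N.+1)%N) F i =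
    \sum_(i | (l i <= N)%N) F i + \sum_(i | l i == N.+1) F i.
  rewrite (bigID (fun i => l i == N.+1))/= addrC; congr +%R; apply: eq_bigl => i.
    by rewrite andbC -ltn_neqAle.
  by case: eqP => [->|]; rewrite ?leqnn ?andbF.
rewrite big_ord_recr/= splitS /A splitS -/(A N).
rewrite [X in _ + X + _](eq_bigr (fun i => a i * h N.+1)) => [|i /eqP -> //].
rewrite -big_distrl/=; set X := \sum_(i | l i == _) _.
have : (B N - A N) * h N.+1 <= (B N - A N) * h N by rewrite ler_wpM2l// subr_ge0 aB.
lra.
Qed.

Lemma logp_nat (R : realType) n : logp (n%:R : R) = ln n%:R.
Proof.
case: n => [|n]; first by rewrite /logp max_r ?ler01// ln1 ln0.
by rewrite /logp max_l// ler1n.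
Qed.

Lemma sum_lattice_monotone_le (R : realType) (alpha : R) (d : nat) :
  1 < alpha -> (0 < d)%N ->
  exists2 C, 0 <= C & forall (h : nat -> R) (M : nat),
    (forall m, 0 <= h m) -> (forall m, h m.+1 <= h m) -> exists N : nat,
    \sum_(g : {ffun 'I_d -> 'I_M})
      (exp_lnpow alpha (lat_norm (box_pt g)) * ln (lat_norm (box_pt g))%:R `^ (alpha - 1)
        / (lat_norm (box_pt g))%:R * h (lat_norm (box_pt g)))
    <= C * (h 0%N + \sum_(m < N)
      (exp_log_weight alpha d m.+1%:R - exp_log_weight alpha d m%:R) * h m.+1).
Proof.
move=> a1 d0; have [C C0 HC] := sum_lattice_le a1 d0.
pose e := expR 1 : R; have e0 : 0 < e by exact: expR_gt0.
pose C1 := C * 2 ^+ d.-1; have C10 : 0 <= C1 by rewrite mulr_ge0.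
pose phi n : R := exp_log_weight alpha d n%:R.
pose B n := C1 * (e + 2 * phi n).
(* Where [L <= 1] the weight [phi] may vanish and the constant [e] takes over; where [L >= 1],
   [1 + L <= 2 L]. *)
have Gphi n : exp_lnpow alpha n * (1 + ln n%:R) ^+ d.-1 <= 2 ^+ d.-1 * (e + 2 * phi n).
  rewrite /phi /exp_log_weight logp_nat -/(exp_lnpow alpha n).
  have L0 := ln_nat_ge0 R n; set L := ln _ in L0 *.
  have G1 : 0 <= exp_lnpow alpha n by rewrite (le_trans ler01)// exp_lnpow_ge1.
  have [L1|/ltW L1] := leP L 1.
    have Ge : exp_lnpow alpha n <= e.
      have La : L `^ alpha <= 1 `^ alpha.
        by rewrite ge0_ler_powR ?nnegrE// ltW// (lt_trans ltr01).
      by rewrite /exp_lnpow /e ler_expR (le_trans La)// powR1.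
    rewrite mulrC ler_pM ?exprn_ge0 ?addr_ge0//.
      have L2 : 1 + L <= 2 by lra.
      by rewrite lerXn2r ?nnegrE ?addr_ge0.
    by rewrite ler_wpDr// !mulr_ge0 ?exprn_ge0.
  apply: (@le_trans _ _ (exp_lnpow alpha n * (2 * L) ^+ d.-1)).
    rewrite ler_wpM2l// lerXn2r ?nnegrE ?addr_ge0 ?mulr_ge0//; lra.
  rewrite exprMn mulrCA ler_wpM2l ?exprn_ge0//.
  have : 0 <= exp_lnpow alpha n * L ^+ d.-1 by rewrite mulr_ge0 ?exprn_ge0.
  lra.
(* This constant covers [B 0], since [phi 0 <= 1], and the increments of [B], which are [2 * C1]
   times those of [phi]. *)
exists (C1 * (e + 2)) => [|h M h0 hm]; first by rewrite mulr_ge0 ?addr_ge0// ltW.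
(* With the largest norm of the box as [N], the condition on levels in the Abel bound holds for
   every [g]. *)
pose N := (\max_(g : {ffun 'I_d -> 'I_M}) lat_norm (box_pt g))%N; exists N.
pose a (g : {ffun 'I_d -> 'I_M}) := exp_lnpow alpha (lat_norm (box_pt g)) *
  ln (lat_norm (box_pt g))%:R `^ (alpha - 1) / (lat_norm (box_pt g))%:R.
have aB j : \sum_(g | (lat_norm (box_pt g) <= j)%N) a g <= B j.
  by rewrite (le_trans (HC M j))// /B /C1 -mulrA ler_wpM2l.
have := abel_sum_le N aB h0 hm.
rewrite (eq_bigl xpredT) => [|g]; last by rewrite /N (bigD1 g)//= leq_maxl.
move=> /le_trans; apply.
have phi0 : phi 0%N <= 1.
  have l0 : logp (0%:R : R) = 0 by rewrite logp_nat (ln0 (lexx 0)).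
  have a_neq0 : alpha != 0 by rewrite gt_eqF// (lt_trans ltr01).
  rewrite /phi /exp_log_weight l0 powR0//.
  by rewrite expR0 mul1r; case: (d.-1) => [|k]; rewrite ?expr0// expr0n.
rewrite [leRHS]mulrDr; apply: lerD.
  by rewrite ler_wpM2r// /B ler_wpM2l// lerD2l; lra.
rewrite mulr_sumr; apply: ler_sum => m _.
have phiS : phi m <= phi m.+1.
  by apply: ler_exp_log_weight; [rewrite ltW// (lt_trans ltr01)|rewrite ler_nat].
rewrite mulrA ler_wpM2r// -/(phi _) -/(phi _).
have : 0 <= C1 * e * (phi m.+1 - phi m) by rewrite !mulr_ge0 ?subr_ge0// ltW.
rewrite /B; lra.
Qed.

(** * Sub-linear expectations and capacities *)

Lemma extend_ord_max (R : Type) (n : nat) (x : 'I_n -> R) (y : R) :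
  extend x y ord_max = y.
Proof. by rewrite /extend unlift_none. Qed.

Lemma extend_widen (R : Type) (n : nat) (x : 'I_n -> R) (y : R) (i : 'I_n) :
  extend x y (widen_ord (leqnSn n) i) = x i.
Proof.
have -> : widen_ord (leqnSn n) i = lift ord_max i by apply: val_inj; rewrite [RHS]lift_max.
by rewrite /extend liftK.
Qed.

(** Induction through [P a - Q b = (P - Q) a + Q (a - b)]. It makes products of bounded Lipschitz
    functions admissible test functions for independence. *)
Lemma dist_prod_le (R : realType) (n : nat) (g : nat -> R -> R) (B K : R)
    (x y : 'I_n -> R) : 1 <= B -> 0 <= K ->
  (forall i u, 0 <= g i u <= B) -> (forall i u v, `|g i u - g i v| <= K * `|u - v|) ->
  `|\prod_(i < n) g i (x i) - \prod_(i < n) g i (y i)|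
    <= B ^+ n * K * \sum_(i < n) `|x i - y i|.
Proof.
move=> B1 K0 gB gK; have B0 : 0 <= B by rewrite (le_trans ler01).
have prodB m (z : 'I_m -> R) : 0 <= \prod_(i < m) g i (z i) <= B ^+ m.
  rewrite prodr_ge0 => [/=|i _]; last by have /andP[] := gB i (z i).
  by rewrite -[m in leRHS]card_ord -prodr_const ler_prod.
elim: n => [|n IH] in x y *; first by rewrite !big_ord0 subrr normr0 mulr0.
rewrite !big_ord_recr/=.
set P := \prod_(i < n) _; set Q := \prod_(i < n) _.
set a := g n _; set b := g n _; set s := \sum_(i < n) _.
have -> : P * a - Q * b = (P - Q) * a + Q * (a - b) by ring.
have /andP[a0 aB] : 0 <= a <= B by exact: gB.
have /andP[Q0 QB] : 0 <= Q <= B ^+ n by exact: (prodB n (fun i => y (widen_ord (leqnSn n) i))).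
have PQ : `|P - Q| <= B ^+ n * K * s.
  exact: (IH (fun i => x (widen_ord (leqnSn n) i)) (fun i => y (widen_ord (leqnSn n) i))).
apply: le_trans (ler_normD _ _) _; rewrite !normrM (ger0_norm a0) (ger0_norm Q0) mulrDr.
apply: lerD.
  have -> : B ^+ n.+1 * K * s = B ^+ n * K * s * B by rewrite exprSr; ring.
  exact: ler_pM.
apply: (@le_trans _ _ (B ^+ n * (K * `|x ord_max - y ord_max|))).
  by rewrite ler_pM// gK.
rewrite mulrA ler_wpM2r// ler_wpM2r// exprSr ler_peMr// exprn_ge0//.
Qed.

(** With growth exponent 0 the polynomial factor is the constant 3. *)
Lemma locLip_of_dist_le (R : realType) (n : nat) (phi : ('I_n -> R) -> R) (C : R) :
  0 <= C -> (forall x y, `|phi x - phi y| <= C * \sum_(i < n) `|x i - y i|) -> locLip phi.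
Proof.
move=> C0 H; exists C, 0%N => x y; apply: le_trans (H x y) _.
rewrite !expr0 ler_wpM2r ?sumr_ge0// ler_peMr//; lra.
Qed.

Lemma capV_ge0 (dT : measure_display) (T : measurableType dT) (R : realType)
  (Pf : set (probability T R)) (A : set T) : Pf !=set0 -> (0 <= capV Pf A)%E.
Proof.
by move=> [P PfP]; apply: (@le_trans _ _ (P A)) => //; apply: ereal_sup_ubound; exists P.
Qed.

Lemma capV_le1 (dT : measure_display) (T : measurableType dT) (R : realType)
  (Pf : set (probability T R)) (A : set T) : measurable A -> (capV Pf A <= 1)%E.
Proof. by move=> mA; apply: ge_ereal_sup => _ [P _ <-]; exact: probability_le1. Qed.

Lemma le_capV (dT : measure_display) (T : measurableType dT) (R : realType)
  (Pf : set (probability T R)) (A B : set T) : measurable A -> measurable B ->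
  A `<=` B -> (capV Pf A <= capV Pf B)%E.
Proof.
move=> mA mB AB; apply: ge_ereal_sup => _ [P PfP <-].
apply: (@le_trans _ _ (P B)); first by apply: le_measure; rewrite ?inE.
by apply: ereal_sup_ubound; exists P.
Qed.

Lemma slE_le (dT : measure_display) (T : measurableType dT) (R : realType)
  (Pf : set (probability T R)) (f : T -> R) (B : R) :
  measurable_fun setT f -> (forall w, 0 <= f w <= B) -> (slE Pf f <= B%:E)%E.
Proof.
move=> mf fB; apply: ge_ereal_sup => _ [P _ <-].
apply: (@le_trans _ _ (\int[P]_x cst B%:E x)%E); last first.
  have -> : (\int[P]_x cst B%:E x = B%:E * P setT)%E by rewrite integral_cst.
  by rewrite probability_setT mule1.
apply: ge0_le_integral => //; first by move=> x _; rewrite lee_fin; case/andP: (fB x).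
  exact/measurable_EFinP.
by move=> x _; rewrite lee_fin; case/andP: (fB x).
Qed.

Lemma slE_ge0 (dT : measure_display) (T : measurableType dT) (R : realType)
  (Pf : set (probability T R)) (f : T -> R) :
  Pf !=set0 -> (forall w, 0 <= f w) -> (0 <= slE Pf f)%E.
Proof.
move=> [P PfP] f0; apply: (@le_trans _ _ (\int[P]_x (f x)%:E)%E).
  by apply: integral_ge0 => x _; rewrite lee_fin.
by apply: ereal_sup_ubound; exists P.
Qed.

Lemma slE_scale (dT : measure_display) (T : measurableType dT) (R : realType)
  (Pf : set (probability T R)) (c : R) (f : T -> R) : Pf !=set0 -> 0 <= c ->
  measurable_fun setT f -> (forall w, 0 <= f w) ->
  slE Pf (fun w => c * f w) = (c%:E * slE Pf f)%E.
Proof.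
move=> [P PfP] c0 mf f0; rewrite /slE -ereal_supZl//; last first.
  by apply/set0P; exists (\int[P]_x (f x)%:E)%E; exists P.
congr ereal_sup; rewrite image_comp.
apply: eq_imagel => Q _ /=.
under eq_integral do rewrite EFinM.
rewrite ge0_integralZl//; first exact/measurable_EFinP.
by move=> x _; rewrite lee_fin.
Qed.

(** Induction on [M]: independence of [Y M] from its predecessors factors the expectation of the
    product exactly. The bounds [B] and [K] make the product a Lipschitz test function, and the
    [kappa i] give the finiteness that [sl_indep] asks for. *)
Lemma slE_prod_le (dT : measure_display) (T : measurableType dT) (R : realType)
  (Pf : set (probability T R)) (Y : nat -> T -> R) (g : nat -> R -> R) (B K : R)
  (kappa : nat -> R) : Pf !=set0 ->
  (forall i, measurable_fun setT (Y i)) ->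
  (forall m, sl_indep Pf (fun i : 'I_m => Y i) (Y m)) ->
  1 <= B -> 0 <= K -> (forall i, measurable_fun setT (g i)) ->
  (forall i u, 0 <= g i u <= B) -> (forall i u v, `|g i u - g i v| <= K * `|u - v|) ->
  (forall i, slE Pf (fun w => g i (Y i w)) <= (kappa i)%:E)%E ->
  forall M, (slE Pf (fun w => (\prod_(i < M) g i (Y i w))%R) <= (\prod_(i < M) kappa i)%R%:E)%E.
Proof.
move=> Pf0 mY indY B1 K0 mg gB gK gkappa.
have B0 : 0 <= B by rewrite (le_trans ler01).
have g0 i u : 0 <= g i u by have /andP[] := gB i u.
have mgY i : measurable_fun setT (fun w => g i (Y i w)) by exact: measurableT_comp (mg i) (mY i).
have kappa0 i : 0 <= kappa i by rewrite -lee_fin (le_trans _ (gkappa i))// slE_ge0.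
have mprod M : measurable_fun setT (fun w => \prod_(i < M) g i (Y i w)).
  by apply: measurable_prod => i _; exact: mgY.
have prod0 M w : 0 <= \prod_(i < M) g i (Y i w) by rewrite prodr_ge0.
elim=> [|M IH].
  by rewrite big_ord0; apply: slE_le => [|w]; rewrite ?big_ord0 ?ler01 ?lexx//;
    under eq_fun do rewrite big_ord0.
pose phi (x : 'I_M.+1 -> R) := \prod_(i < M.+1) g i (x i).
have phiE (x : 'I_M -> R) y : phi (extend x y) = \prod_(i < M) g i (x i) * g M y.
  rewrite /phi big_ord_recr/= extend_ord_max; congr (_ * _).
  by apply: eq_bigr => i _; rewrite extend_widen.
have phi_lip : locLip phi.
  apply: (@locLip_of_dist_le _ _ _ (B ^+ M.+1 * K)); first by rewrite mulr_ge0 ?exprn_ge0.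
  by move=> x y; exact: dist_prod_le.
pose EM := slE Pf (fun w => g M (Y M w)).
have EM_fin : EM \is a fin_num.
  by rewrite ge0_fin_numE ?slE_ge0// (le_lt_trans (gkappa M)) ?ltry.
have phibarE (x : 'I_M -> R) : slE Pf (fun w => phi (extend x (Y M w))) =
    ((\prod_(i < M) g i (x i)) * fine EM)%:E.
  rewrite EFinM fineK// /EM -slE_scale//; last by rewrite prodr_ge0.
  by congr slE; apply/funext => w; rewrite phiE.
have phibar_normE (x : 'I_M -> R) : slE Pf (fun w => `|phi (extend x (Y M w))|) =
    ((\prod_(i < M) g i (x i)) * fine EM)%:E.
  by rewrite -phibarE; congr slE; apply/funext => w; rewrite ger0_norm// prodr_ge0.
have fEM0 : 0 <= fine EM by rewrite fine_ge0// slE_ge0.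
have EMkappa : fine EM <= kappa M by rewrite -lee_fin fineK ?gkappa.
have scaled : slE Pf (fun w => \prod_(i < M) g i (Y i w) * fine EM) =
    ((fine EM)%:E * slE Pf (fun w => (\prod_(i < M) g i (Y i w))%R))%E.
  by rewrite -slE_scale//; congr slE; apply/funext => w; rewrite mulrC.
have scaled_le : (slE Pf (fun w => (\prod_(i < M) g i (Y i w)) * fine EM)%R
    <= (\prod_(i < M.+1) kappa i)%R%:E)%E.
  by rewrite scaled big_ord_recr/= mulrC EFinM lee_pmul ?lee_fin ?slE_ge0//; exact: prod0.
(* As all factors are nonnegative, the absolute values in [sl_indep] disappear and both sides reduce
   to the product times [fine EM]. *)
have := indY M phi phi_lip => /=.
have -> : (fun w => phi (extend (fun i : 'I_M => Y i w) (Y M w))) =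
    (fun w => \prod_(i < M.+1) g i (Y i w)).
  by apply/funext => w; rewrite phiE big_ord_recr.
have -> : (fun w => fine (slE Pf (fun w' => phi (extend (fun i : 'I_M => Y i w) (Y M w'))))) =
    (fun w => \prod_(i < M) g i (Y i w) * fine EM).
  by apply/funext => w; rewrite phibarE.
have -> : (fun w => `|fine (slE Pf (fun w' => `|phi (extend (fun i : 'I_M => Y i w) (Y M w'))|))|) =
    (fun w => \prod_(i < M) g i (Y i w) * fine EM).
  by apply/funext => w; rewrite phibar_normE/= ger0_norm// mulr_ge0 ?prod0.
move=> ->; [exact: scaled_le| |]; first by move=> x; rewrite phibar_normE ltry.
by rewrite (le_lt_trans scaled_le) ?ltry.
Qed.

(** * Tail capacities and the Choquet integral *)

Lemma measurable_exp_log_weight (R : realType) (alpha : R) (d : nat) :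
  measurable_fun setT (exp_log_weight alpha d).
Proof.
have mlogp : measurable_fun setT (@logp R).
  apply: (measurableT_comp (@measurable_ln R)).
  exact: measurable_maxr.
apply: measurable_funM; last exact: measurable_funX.
apply: (measurableT_comp (@measurable_expR R)).
exact: (measurableT_comp (@measurable_powR R alpha)).
Qed.

Lemma measurable_setlt (dT : measure_display) (T : measurableType dT) (R : realType)
  (f : T -> R) (x : R) : measurable_fun setT f -> measurable [set w | x < f w].
Proof.
move=> mf; have := mf measurableT `]x, +oo[%classic (measurable_itv _).
by rewrite setTI; congr measurable; apply/seteqP; split => w /=; rewrite in_itv/= andbT.
Qed.

Lemma capV_fine (dT : measure_display) (T : measurableType dT) (R : realType)
  (Pf : set (probability T R)) (A : set T) : Pf !=set0 -> measurable A ->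
  capV Pf A = (fine (capV Pf A))%:E.
Proof.
move=> Pf0 mA; rewrite fineK// ge0_fin_numE ?capV_ge0//.
by rewrite (le_lt_trans (capV_le1 Pf mA)) ?ltry.
Qed.

(** A real-valued tail function; for measurable [f] and a nonempty family, [fine] loses nothing,
    since the capacity lies in [0, 1]. *)
Definition tailV (dT : measure_display) (T : measurableType dT) (R : realType)
  (Pf : set (probability T R)) (f : T -> R) (x : R) : R :=
  fine (capV Pf [set w | x < f w]).

Lemma tailVE (dT : measure_display) (T : measurableType dT) (R : realType)
  (Pf : set (probability T R)) (f : T -> R) (x : R) : Pf !=set0 ->
  measurable_fun setT f -> capV Pf [set w | x < f w] = (tailV Pf f x)%:E.
Proof. by move=> Pf0 mf; rewrite -capV_fine//; exact: measurable_setlt. Qed.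

Lemma tailV_ge0 (dT : measure_display) (T : measurableType dT) (R : realType)
  (Pf : set (probability T R)) (f : T -> R) (x : R) : Pf !=set0 -> 0 <= tailV Pf f x.
Proof. by move=> Pf0; rewrite fine_ge0// capV_ge0. Qed.

Lemma tailV_le (dT : measure_display) (T : measurableType dT) (R : realType)
  (Pf : set (probability T R)) (f g : T -> R) (x y : R) : Pf !=set0 ->
  measurable_fun setT f -> measurable_fun setT g ->
  (forall w, x < f w -> y < g w) -> tailV Pf f x <= tailV Pf g y.
Proof.
move=> Pf0 mf mg fg; rewrite -lee_fin -!tailVE//.
by apply: le_capV => //; exact: measurable_setlt.
Qed.

Lemma measurable_tailV (dT : measure_display) (T : measurableType dT) (R : realType)
  (Pf : set (probability T R)) (f : T -> R) (D : set R) : Pf !=set0 -> measurable D ->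
  measurable_fun setT f -> measurable_fun D (fun x => (tailV Pf f x)%:E).
Proof.
move=> Pf0 mD mf; apply/measurable_EFinP; apply: nonincreasing_measurable => // x y xy.
by apply: tailV_le => // w; exact: le_lt_trans.
Qed.

(** For [x < 0] the event is the whole space, of capacity 1, so the negative half vanishes. *)
Lemma choquetV_ge0E (dT : measure_display) (T : measurableType dT) (R : realType)
  (Pf : set (probability T R)) (f : T -> R) : Pf !=set0 ->
  measurable_fun setT f -> (forall w, 0 <= f w) ->
  choquetV Pf f = (\int[@lebesgue_measure R]_(x in `[0%R, +oo[%classic) (tailV Pf f x)%:E)%E.
Proof.
move=> Pf0 mf f0; rewrite /choquetV [X in (_ + X)%E](_ : _ = 0%E) ?adde0.
  by apply: eq_integral => x _; rewrite tailVE.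
rewrite -[RHS](integral0 (@lebesgue_measure R) `]-oo, 0%R[%classic).
apply: eq_integral => x; rewrite inE/= in_itv/= => x0.
have -> : [set w | x < f w] = setT by apply/seteqP; split => // w _ /=; exact: lt_le_trans (f0 w).
suff -> : capV Pf setT = 1%E by rewrite subee.
apply/eqP; rewrite eq_le capV_le1//=; have [P PfP] := Pf0.
by rewrite -(probability_setT P); apply: ereal_sup_ubound; exists P.
Qed.

(** Layer-cake formula under [P], then [P <= V] on each tail event. *)
Lemma integral_le_choquetV (dT : measure_display) (T : measurableType dT) (R : realType)
  (Pf : set (probability T R)) (f : T -> R) (P : probability T R) : Pf P ->
  measurable_fun setT f -> (forall w, 0 <= f w) ->
  (\int[P]_w (f w)%:E <= choquetV Pf f)%E.
Proof.
move=> PfP mf f0; have Pf0 : Pf !=set0 by exists P.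
rewrite choquetV_ge0E//.
pose F : {mfun T >-> R} := mfun_Sub (mem_set mf).
have := ge0_expectation_ccdf (P := P) (X := F) f0.
rewrite unlock => ->; apply: ge0_le_integral => //.
- by apply: measurable_funTS; exact: ccdf_measurable.
- exact: measurable_tailV.
move=> x _; rewrite -tailVE// /ccdf /distribution /pushforward.
apply: ereal_sup_ubound; exists P => //; congr (P _).
by apply/seteqP; split => w /=; rewrite in_itv/= andbT.
Qed.

(** The left side is a lower Riemann sum of the non-increasing [h] on the partition by
    [phi 0, ..., phi N]. This turns the Abel sum into the Choquet integral. *)
Lemma sum_increment_le_integral (R : realType) (h : R -> R) (phi : nat -> R) (N : nat) :
  (forall x, 0 <= h x) -> {homo h : x y /~ y <= x} ->
  0 <= phi 0%N -> (forall m, phi m <= phi m.+1) ->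
  ((\sum_(m < N) (phi m.+1 - phi m) * h (phi m.+1))%:E
    <= \int[@lebesgue_measure R]_(x in `[0%R, +oo[%classic) (h x)%:E)%E.
Proof.
move=> h0 hh phi0 phiS.
have mh D : measurable D -> measurable_fun D (fun x => (h x)%:E).
  by move=> mD; apply/measurable_EFinP; exact: nonincreasing_measurable.
have phi0m m : phi 0%N <= phi m by elim: m => // m /le_trans; apply.
apply: (@le_trans _ _ (\int[@lebesgue_measure R]_(x in `[phi 0%N, phi N[%classic) (h x)%:E)%E).
  elim: N => [|N IH].
    by rewrite big_ord0; apply: integral_ge0 => x _; rewrite lee_fin.
  rewrite big_ord_recr/= EFinD.
  rewrite (@itv_bndbnd_setU _ _ (BLeft (phi 0%N)) (BLeft (phi N)) (BLeft (phi N.+1))) ?bnd_simp//.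
  rewrite ge0_integral_setU//=; last 3 first.
  - by apply: mh; exact: measurableU.
  - by move=> x _; rewrite lee_fin.
  - apply/disj_setPS => x [/=]; rewrite !in_itv/= => /andP[_ xN] /andP[Nx _].
    by move: (lt_le_trans xN Nx); rewrite ltxx.
  apply: leeD => //.
  apply: (@le_trans _ _ (\int[@lebesgue_measure R]_(x in `[phi N, phi N.+1[%classic)
    cst (h (phi N.+1))%:E x)%E).
    rewrite integral_cst// muleC EFinM lee_wpmul2r ?lee_fin//.
    rewrite [leRHS]lebesgue_measure_itv/= lte_fin.
    by case: ltP => [_|]; rewrite ?EFinB// => Nn; rewrite lee_fin subr_le0.
  apply: ge0_le_integral => //; [by move=> x _; rewrite lee_fin|exact: mh|].
  by move=> x /=; rewrite in_itv/= lee_fin => /andP[_ /ltW]; exact: hh.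
apply: ge0_subset_integral => //; [exact: mh|by move=> x _; rewrite lee_fin|].
by move=> x /=; rewrite !in_itv/= andbT => /andP[+ _]; exact: le_trans.
Qed.

(** Used with [V] equal to [X] or [-X] and [Z] the moment weight: the linear term has nonpositive
    mean, and [V^2 <= C + Z] bounds the quadratic one. *)
Lemma integral_le_of_quadratic_bound (dT : measure_display) (T : measurableType dT)
  (R : realType) (P : probability T R) (V Z F : T -> R) (C K t s r : R) :
  measurable_fun setT V -> measurable_fun setT Z -> measurable_fun setT F ->
  (forall w, 0 <= Z w) -> (\int[P]_w (Z w)%:E <= K%:E)%E ->
  (\int[P]_w (V w)%:E <= 0)%E -> (forall w, V w ^+ 2 <= C + Z w) -> 0 <= C ->
  0 <= t -> 0 <= s -> 0 <= r ->
  (forall w, 0 <= F w <= 1 + t * V w + s * V w ^+ 2 + r * Z w) ->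
  (\int[P]_w (F w)%:E <= (1 + s * (C + K) + r * K)%:E)%E.
Proof.
move=> mV mZ mF Z0 ZK V0 VZ C0 t0 s0 r0 Fle.
have intZ : P.-integrable setT (EFin \o Z).
  apply/integrableP; split; first exact/measurable_EFinP.
  under eq_integral do rewrite /= ger0_norm//.
  by rewrite (le_lt_trans ZK) ?ltry.
have intc a : P.-integrable setT (EFin \o cst a : T -> \bar R).
  exact: finite_measure_integrable_cst.
have intaddZ a b : P.-integrable setT (EFin \o (fun w => a + b * Z w)).
  have := integrableD measurableT (intc a) (integrableZl measurableT b intZ).
  by apply: eq_integrable => // w _; rewrite /= EFinD EFinM.
(* Integrability follows from [2 |V| <= 1 + V^2] and [V^2 <= C + Z]. *)
have intV : P.-integrable setT (EFin \o V).
  apply: (le_integrable measurableT _ _ (intaddZ (1 + C) 1)).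
    exact/measurable_EFinP.
  move=> w _; rewrite /= lee_fin mul1r [leRHS]ger0_norm ?addr_ge0//.
  have := VZ w; rewrite -real_normK ?num_real//.
  have := sqr_ge0 (`|V w| - 1); have := normr_ge0 (V w).
  by set a := `|V w|; move=> a0 a1 a2; nra.
pose G w := (1 + s * C + (s + r) * Z w) + t * V w.
have FG w : F w <= G w.
  have /andP[_ /le_trans] := Fle w; apply; rewrite /G.
  have : s * V w ^+ 2 <= s * (C + Z w) by rewrite ler_wpM2l.
  lra.
have F0 w : 0 <= F w by case/andP: (Fle w).
have intG : P.-integrable setT (EFin \o G).
  have := integrableD measurableT (intaddZ (1 + s * C) (s + r)) (integrableZl measurableT t intV).
  by apply: eq_integrable => // w _; rewrite /= EFinD EFinM.
have intF : P.-integrable setT (EFin \o F).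
  apply: (le_integrable measurableT _ _ intG); first exact/measurable_EFinP.
  by move=> w _; rewrite /= lee_fin !ger0_norm// (le_trans (F0 w)).
apply: (@le_trans _ _ (\int[P]_w (G w)%:E)%E).
  by apply: le_integral => // w _; rewrite lee_fin.
have tV : (\int[P]_w (t%:E * (EFin \o V) w) <= 0)%E.
  by rewrite integralZl// mule_ge0_le0 ?lee_fin.
have bZ : (\int[P]_w ((s + r)%:E * (EFin \o Z) w) <= ((s + r) * K)%:E)%E.
  by rewrite integralZl// EFinM lee_wpmul2l ?lee_fin ?addr_ge0.
have -> : (\int[P]_w (G w)%:E = \int[P]_w (((EFin \o cst (1 + s * C)%R) w +
    (s + r)%:E * (EFin \o Z) w) + t%:E * (EFin \o V) w))%E.
  by apply: eq_integral => w _; rewrite /= /G !EFinD !EFinM.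
rewrite integralD//; last 2 first.
- exact: (integrableD measurableT (intc (1 + s * C)) (integrableZl measurableT (s + r) intZ)).
- exact: integrableZl.
rewrite integralD//; last exact: integrableZl.
have -> : (\int[P]_w (EFin \o cst (1 + s * C)%R) w = (1 + s * C)%:E)%E.
  have -> : (\int[P]_w (EFin \o cst (1 + s * C)%R) w = (1 + s * C)%:E * P setT)%E.
    by rewrite -integral_cst.
  by rewrite probability_setT mule1.
have -> : (1 + s * (C + K) + r * K)%:E = ((1 + s * C)%:E + ((s + r) * K)%:E + 0)%E.
  by rewrite adde0 -EFinD; congr EFin; ring.
by apply: leeD => //; apply: leeD.
Qed.

(** * Lipschitz test functions and identical distribution *)

Lemma dist_minr_le (R : realType) (a b y : R) :
  `|Num.min a y - Num.min b y| <= `|a - b|.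
Proof.
have [ay|ya] := leP a y; have [b_y|yb] := leP b y; rewrite ?subrr ?normr0//;
  rewrite ler_norml lerNl !ler_normr; lra.
Qed.

Lemma dist_maxr_le (R : realType) (a b y : R) :
  `|Num.max a y - Num.max b y| <= `|a - b|.
Proof.
have := dist_minr_le (- a) (- b) (- y).
by rewrite -!oppr_max -!opprD !normrN.
Qed.

(** For [b <= a], [exp a - exp b = exp a (1 - exp (b - a)) <= exp a (a - b)]. Truncation from above
    thus makes the exponential Lipschitz. *)
Lemma dist_expR_le (R : realType) (a b M : R) : a <= M -> b <= M ->
  `|expR a - expR b| <= expR M * `|a - b|.
Proof.
wlog ab : a b / b <= a => [H aM bM|aM _].
  have [/H|/ltW/H] := leP b a; first exact.
  by rewrite distrC (distrC a); exact.
rewrite !ger0_norm ?subr_ge0 ?ler_expR//.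
apply: (@le_trans _ _ (expR a * (a - b))); last first.
  by rewrite ler_wpM2r ?subr_ge0 ?ler_expR.
have -> : expR b = expR a * expR (b - a) by rewrite -expRD subrKC.
rewrite -{1}[expR a]mulr1 -mulrBr ler_wpM2l ?expR_ge0//.
have := expR_ge1Dx (b - a); lra.
Qed.

Lemma ident_distr_slE (dT : measure_display) (T : measurableType dT) (R : realType)
  (Pf : set (probability T R)) (Y X : T -> R) (g : R -> R) (K : R) :
  ident_distr Pf Y X -> 0 <= K -> (forall u v, `|g u - g v| <= K * `|u - v|) ->
  slE Pf (fun w => g (Y w)) = slE Pf (fun w => g (X w)).
Proof.
move=> YX K0 gK; apply: (YX (fun x => g (x ord0))).
by apply: (locLip_of_dist_le K0) => x y; rewrite big_ord_recl big_ord0 addr0.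
Qed.

(* Identical distribution only controls Lipschitz test functions, hence the
   loss from [s] to [r]. *)
Lemma ident_distr_tail_le (dT : measure_display) (T : measurableType dT) (R : realType)
  (Pf : set (probability T R)) (Y X : T -> R) (P : probability T R) (r s : R) :
  Pf P -> measurable_fun setT Y -> measurable_fun setT X -> ident_distr Pf Y X -> r < s ->
  (P [set w | (s < `|Y w|)%R] <= (tailV Pf (fun w => `|X w|%R) r)%:E)%E.
Proof.
move=> PfP mY mX YX rs; have Pf0 : Pf !=set0 by exists P.
have sr0 : 0 < s - r by rewrite subr_gt0.
(* A ramp in [|u|], from 0 at [r] to 1 at [s], lying between the indicators of [|u| > s] and
   [|u| > r]. *)
pose g (u : R) : R := Num.max (Num.min ((`|u| - r) / (s - r)) 1) 0.
have g0 u : 0 <= g u by rewrite le_max lexx orbT.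
have g1 u : g u <= 1 by rewrite ge_max ge_min lexx orbT ler01.
have gs u : s < `|u| -> g u = 1.
  move=> su; rewrite /g min_r ?max_l//.
  by rewrite ler_pdivlMr// mul1r lerB// ltW.
have gr u : `|u| <= r -> g u = 0.
  move=> ur; rewrite /g max_r// ge_min; apply/orP; left.
  by rewrite pmulr_lle0 ?invr_gt0// subr_le0.
have gK u v : `|g u - g v| <= (s - r)^-1 * `|u - v|.
  apply: le_trans (dist_maxr_le _ _ _) _; apply: le_trans (dist_minr_le _ _ _) _.
  have -> : (`|u| - r) / (s - r) - (`|v| - r) / (s - r) = (s - r)^-1 * (`|u| - `|v|).
    by ring.
  rewrite normrM ger0_norm ?invr_ge0 ?(ltW sr0)//.
  by rewrite ler_wpM2l ?invr_ge0 ?(ltW sr0)// ler_dist_dist.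
have mg : measurable_fun setT g.
  apply: measurable_maxr => //; apply: measurable_minr => //.
  by apply: measurable_funM => //; apply: measurable_funB => //; exact: measurable_normr.
have mnorm (f : T -> R) : measurable_fun setT f -> measurable_fun setT (fun w => `|f w|).
  by move=> mf; exact: measurableT_comp.
have indT (Q : probability T R) (A : set T) : measurable A ->
    (\int[Q]_w (\1_A w)%:E = Q A)%E by move=> mA; rewrite integral_indic// setIT.
have mYs := measurable_setlt s (mnorm _ mY).
have mXr := measurable_setlt r (mnorm _ mX).
apply: (@le_trans _ _ (slE Pf (fun w => g (Y w)))).
  apply: (@le_trans _ _ (\int[P]_w (g (Y w))%:E)%E); last by apply: ereal_sup_ubound; exists P.
  rewrite -indT//; apply: ge0_le_integral => //.
  - exact/measurable_EFinP/measurable_indic.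
  - by apply/measurable_EFinP; exact: measurableT_comp.
  move=> w _; rewrite lee_fin indicE; case: (boolP (w \in _)) => [|_] //.
  by rewrite inE/= => /gs ->.
have sr0' : 0 <= (s - r)^-1 by rewrite invr_ge0 ltW.
rewrite (ident_distr_slE YX sr0' gK) -tailVE ?mnorm//; last exact: mnorm.
apply: ge_ereal_sup => _ [Q PfQ <-].
apply: (@le_trans _ _ (Q [set w | (r < `|X w|)%R])); last by apply: ereal_sup_ubound; exists Q.
rewrite -indT//; apply: ge0_le_integral => //.
- by move=> w _; rewrite lee_fin.
- by apply/measurable_EFinP; exact: measurableT_comp.
- exact/measurable_EFinP/measurable_indic.
move=> w _; rewrite lee_fin indicE; case: (boolP (w \in _)) => [_|] //.
by rewrite notin_setE/= => /negP; rewrite -leNgt => /gr ->.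
Qed.

Lemma markov_expR (dT : measure_display) (T : measurableType dT) (R : realType)
  (P : probability T R) (F : T -> R) (x b : R) :
  measurable_fun setT F -> (forall w, 0 <= F w) -> (\int[P]_w (F w)%:E <= b%:E)%E ->
  (P [set w | (expR x <= F w)%R] <= (expR (- x) * b)%:E)%E.
Proof.
move=> mF F0 Fb.
have mFE : measurable_fun setT (EFin \o F) by exact/measurable_EFinP.
have := le_integral_abse P measurableT mFE (expR_gt0 x).
have -> : setT `&` [set w | ((expR x)%:E <= `|(EFin \o F) w|)%E] = [set w | expR x <= F w].
  by rewrite setTI; apply/seteqP; split => w /=; rewrite lee_fin ger0_norm.
under eq_integral do rewrite /= ger0_norm//.
move=> /le_trans/(_ Fb) H.
by rewrite expRN EFinM lee_pdivlMl ?expR_gt0.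
Qed.

(** * Tail bound for partial sums *)

(** Independence is given along a whole enumeration, while the sum runs over a subset [J] of
    indices: factors outside [J] are replaced by 1. The sign [sigma] serves both tails. *)
Lemma slE_prod_trunc_le (dT : measure_display) (T : measurableType dT) (R : realType)
  (Pf : set (probability T R)) (Y : nat -> T -> R) (X : T -> R) (J : pred nat)
  (sigma t y kappa : R) : Pf !=set0 ->
  (forall i, measurable_fun setT (Y i)) ->
  (forall m, sl_indep Pf (fun i : 'I_m => Y i) (Y m)) ->
  (forall i, ident_distr Pf (Y i) X) ->
  `|sigma| = 1 -> 0 <= t ->
  (slE Pf (fun w => expR (t * Num.min (sigma * X w)%R y)) <= kappa%:E)%E ->
  forall M, (slE Pf (fun w => (\prod_(i < M | J i) expR (t * Num.min (sigma * Y i w) y))%R)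
    <= (kappa ^+ #|[pred i : 'I_M | J i]|)%:E)%E.
Proof.
move=> Pf0 mY indY YX s1 t0 Hk M.
pose g0 (u : R) := expR (t * Num.min (sigma * u) y).
pose g (i : nat) (u : R) : R := if J i then g0 u else 1.
pose B := expR (t * `|y|); have B1 : 1 <= B by rewrite -[leLHS]expR0 ler_expR mulr_ge0.
have g0B u : 0 <= g0 u <= B.
  rewrite expR_ge0 ler_expR ler_wpM2l//.
  by rewrite (le_trans _ (ler_norm y))// ge_min lexx orbT.
have K0 : 0 <= B * t by rewrite mulr_ge0 ?expR_ge0.
have g0K u v : `|g0 u - g0 v| <= B * t * `|u - v|.
  apply: (le_trans (@dist_expR_le _ _ _ (t * `|y|) _ _)).
  - by rewrite -ler_expR; case/andP: (g0B u).
  - by rewrite -ler_expR; case/andP: (g0B v).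
  rewrite -mulrA ler_wpM2l ?expR_ge0// -mulrBr normrM ger0_norm// ler_wpM2l//.
  by apply: le_trans (dist_minr_le _ _ _) _; rewrite -mulrBr normrM s1 mul1r.
have mg0 : measurable_fun setT g0.
  apply: (measurableT_comp (@measurable_expR R)); apply: measurable_funM => //.
  by apply: measurable_minr => //; exact: measurable_funM.
have -> : kappa ^+ #|[pred i : 'I_M | J i]| = \prod_(i < M) (if J i then kappa else 1).
  by rewrite -big_mkcond/= prodr_const.
have -> : (fun w => \prod_(i < M | J i) expR (t * Num.min (sigma * Y i w) y)) =
    (fun w => \prod_(i < M) g i (Y i w)).
  by apply/funext => w; rewrite big_mkcond.
apply: (slE_prod_le (B := B) (K := B * t) (kappa := fun i => if J i then kappa else 1)) => //.
- by move=> i; rewrite /g; case: (J i).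
- by move=> i u; rewrite /g; case: (J i) => //; rewrite ler01 B1.
- by move=> i u v; rewrite /g; case: (J i) => //; rewrite subrr normr0 mulr_ge0.
move=> i; rewrite /g; case: (J i); last by apply: slE_le => // w; rewrite ler01 lexx.
by rewrite (ident_distr_slE (YX i) K0 g0K).
Qed.

(** Either some [|Y i|] with [i] in [J] exceeds [y], or truncation is inactive and one of the two
    signed exponential products reaches [exp (t x)]. The first event is handled by a union bound,
    the second by Markov's inequality. *)
Lemma capV_sum_le (dT : measure_display) (T : measurableType dT) (R : realType)
  (Pf : set (probability T R)) (Y : nat -> T -> R) (X : T -> R) (J : pred nat)
  (M : nat) (x r y t kappa : R) : Pf !=set0 ->
  (forall i, measurable_fun setT (Y i)) -> measurable_fun setT X ->
  (forall m, sl_indep Pf (fun i : 'I_m => Y i) (Y m)) ->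
  (forall i, ident_distr Pf (Y i) X) -> r < y -> 0 <= t ->
  (forall sigma : R, `|sigma| = 1 ->
    (slE Pf (fun w => expR (t * Num.min (sigma * X w)%R y)) <= kappa%:E)%E) ->
  (capV Pf [set w | (x < `|\sum_(i < M | J i) Y i w|)%R] <=
    (#|[pred i : 'I_M | J i]|%:R * tailV Pf (fun w => `|X w|%R) r
      + 2 * (expR (- (t * x)) * kappa ^+ #|[pred i : 'I_M | J i]|))%:E)%E.
Proof.
move=> Pf0 mY mX indY YX ry t0 Hk; set n := #|_|.
pose F sigma w : R := \prod_(i < M | J i) expR (t * Num.min (sigma * Y i w) y).
have mF sigma : measurable_fun setT (F sigma).
  have -> : F sigma = fun w =>
      \prod_(i < M) if J i then expR (t * Num.min (sigma * Y i w) y) else 1.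
    by apply/funext => w; rewrite /F big_mkcond.
  apply: measurable_prod => i _; case: (J i) => //.
  apply: (measurableT_comp (@measurable_expR R)); apply: measurable_funM => //.
  by apply: measurable_minr => //; exact: measurable_funM.
have F0 sigma w : 0 <= F sigma w by rewrite prodr_ge0// => i _; exact: expR_ge0.
have mnY i : measurable_fun setT (fun w => `|Y i w|) by exact: measurableT_comp.
have mS : measurable_fun setT (fun w => `|\sum_(i < M | J i) Y i w|).
  apply: measurableT_comp => //.
  have -> : (fun w => \sum_(i < M | J i) Y i w) = fun w => \sum_(i < M) if J i then Y i w else 0.
    by apply/funext => w; rewrite big_mkcond.
  by apply: measurable_sum => i; case: (J i).
apply: ge_ereal_sup => _ [P PfP <-].
pose A (i : nat) := if J i then [set w | y < `|Y i w|] else set0.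
have mA i : measurable (A i) by rewrite /A; case: (J i) => //; exact: measurable_setlt.
pose E sigma := [set w | expR (t * x) <= F sigma w].
have mE sigma : measurable (E sigma).
  have := mF sigma measurableT `[expR (t * x), +oo[%classic (measurable_itv _).
  by rewrite setTI; congr measurable; apply/seteqP; split => w /=; rewrite in_itv/= andbT.
have EP (sigma : R) : `|sigma| = 1 -> (P (E sigma) <= (expR (- (t * x)) * kappa ^+ n)%:E)%E.
  move=> s1; apply: markov_expR => //.
  apply: le_trans (slE_prod_trunc_le J Pf0 mY indY YX s1 t0 (Hk _ s1) M).
  by apply: ereal_sup_ubound; exists P.
pose U := \big[setU/set0]_(i < M) A i.
have mU : measurable U by exact: bigsetU_measurable.
have sub : [set w | x < `|\sum_(i < M | J i) Y i w|] `<=` U `|` (E 1 `|` E (-1)).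
  move=> w /= xS; case: (pselect (U w)) => [|nU]; [by left|right].
  have small (i : 'I_M) : J i -> `|Y i w| <= y.
    move=> Ji; rewrite leNgt; apply/negP => yY; apply: nU.
    by rewrite /U -bigcup_mkord; exists i; rewrite /=?ltn_ord// /A Ji.
  have FE (sigma : R) : `|sigma| = 1 -> F sigma w = expR (t * (sigma * \sum_(i < M | J i) Y i w)).
    move=> s1; rewrite /F mulr_sumr mulr_sumr expR_sum.
    apply: eq_bigr => i Ji; rewrite min_l// (le_trans _ (small i Ji))//.
    by rewrite -[leRHS]mul1r -s1 -normrM ler_norm.
  move: xS; rewrite ltr_normr => /orP[xS|xS]; [left|right];
    rewrite /E /= FE ?normrN ?normr1// ler_expR ler_wpM2l// ?mul1r ?mulN1r ltW//.
have mSx : measurable [set w | x < `|\sum_(i < M | J i) Y i w|] by exact: measurable_setlt.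
apply: (@le_trans _ _ (P (U `|` (E 1 `|` E (-1))))).
  by apply: le_measure => //; rewrite inE//; apply: measurableU => //; exact: measurableU.
apply: (@le_trans _ _ (P U + (P (E 1%R) + P (E (-1)%R)))%E).
  apply: (le_trans (measureU2 P mU (measurableU _ _ (mE 1) (mE (-1))))).
  by rewrite leeD2l//; apply: measureU2.
rewrite EFinD mulr2n mulrDl mul1r EFinD; apply: leeD; last first.
  by apply: leeD; apply: EP; rewrite ?normrN normr1.
apply: (@le_trans _ _ (\sum_(i < M) P (A i))%E); first exact: Boole_inequality.
rewrite /n mulr_natl -sumr_const -sumEFin [leRHS]big_mkcond/=; apply: lee_sum => i _.
rewrite /A inE; case: (J i); last by rewrite measure0.
exact: ident_distr_tail_le.
Qed.

(** * Enumerating the points of a rectangle *)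

(** The initial segment of length [M] of the enumeration contains the whole rectangle. Values in any
    [nmodType] are allowed because the same [M] must serve both the partial sum and the count of its
    terms. *)
Lemma lattice_rect_sum (d : nat) (n : {ffun 'I_d -> nat})
  (e : nat -> {ffun 'I_d -> nat}) : injective e -> (forall m, @posidx d (e m)) ->
  (forall k, @posidx d k -> exists m, e m = k) ->
  exists M : nat, forall (V : nmodType) (F : {ffun 'I_d -> nat} -> V),
  \sum_(f : {ffun 'I_d -> 'I_(\sum_(i < d) n i).+1}
          | [forall i, (0 < f i)%N && (f i <= n i)%N]) F [ffun i => nat_of_ord (f i)]
  = \sum_(i < M | [forall j, e i j <= n j]%N) F (e i).
Proof.
move=> einj epos esurj; pose N := (\sum_(i < d) n i)%N.
pose k (f : {ffun 'I_d -> 'I_N.+1}) : {ffun 'I_d -> nat} := [ffun i => nat_of_ord (f i)].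
(* The implication leaves the index arbitrary when [f] has a zero coordinate; such [f] are never
   summed. *)
have inv_ex (f : {ffun 'I_d -> 'I_N.+1}) : exists m, [forall i, (0 < f i)%N] -> e m = k f.
  case: (boolP [forall i, (0 < f i)%N]) => [/forallP f0|_]; last by exists 0%N.
  have kf : @posidx d (k f) by move=> i; rewrite ffunE; exact: f0.
  by have [m em] := esurj _ kf; exists m.
have [m mE] := boolp.choice inv_ex.
pose M := (\max_f m f)%N; exists M.+1 => V F.
pose h f : 'I_M.+1 := inord (m f).
pose h' (i : 'I_M.+1) : {ffun 'I_d -> 'I_N.+1} := [ffun j => inord (e i j)].
have hE f : h f = m f :> nat.
  by rewrite inordK// ltnS /M (bigD1 f)//= leq_maxl.
have leN j : (n j <= N)%N by rewrite /N (bigD1 j)//= leq_addr.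
have kh' (i : 'I_M.+1) : [forall j, e i j <= n j]%N -> k (h' i) = e i.
  move=> /forallP ein; apply/ffunP => j; rewrite !ffunE inordK//.
  by rewrite ltnS (leq_trans (ein j)).
have pos_h' (i : 'I_M.+1) : [forall j, e i j <= n j]%N -> [forall j, 0 < h' i j]%N.
  move=> ein; apply/forallP => j; have /ffunP/(_ j) := kh' i ein.
  by rewrite ffunE => ->; exact: epos.
rewrite [RHS](reindex_onto h h'); last first.
  move=> i ein; apply: val_inj; rewrite /= hE; apply: einj.
  by rewrite mE ?kh'// pos_h'.
apply: eq_big => [f|f /forallP fn]; last first.
  by rewrite hE mE//; apply/forallP => i; case/andP: (fn i).
apply/forallP/andP => [fn|[/forallP ein /eqP h'f] i].
  have f0 : [forall i, 0 < f i]%N by apply/forallP => i; case/andP: (fn i).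
  have em := mE f f0; split.
    by apply/forallP => j; rewrite hE em ffunE; case/andP: (fn j).
  apply/eqP/ffunP => j; apply: val_inj; rewrite ffunE hE em ffunE /= inordK//.
have /forallP ein' : [forall j, e (h f) j <= n j]%N by apply/forallP.
have := kh' (h f) (introT forallP ein); rewrite h'f => kf.
have kfi : nat_of_ord (f i) = e (h f) i by rewrite -kf ffunE.
by rewrite kfi ein andbT; exact: epos.
Qed.

(** The rectangle is a product of intervals, so its cardinality factors; the ambient bound [N] cuts
    nothing off because [n i <= N]. *)
Lemma lattice_rect_card (d : nat) (n : {ffun 'I_d -> nat}) :
  (\sum_(f : {ffun 'I_d -> 'I_(\sum_(i < d) n i).+1}
          | [forall i, (0 < f i)%N && (f i <= n i)%N]) 1)%N = lat_norm n.
Proof.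
set N := (\sum_(i < d) n i)%N.
rewrite (eq_big (mem (family (fun i : 'I_d => [pred j : 'I_N.+1 | (0 < j <= n i)%N])))
  (fun f : {ffun 'I_d -> 'I_N.+1} => \prod_(i < d) 1)%N); first last.
- by move=> f _; rewrite big1.
- by move=> f; apply/forallP/familyP.
rewrite -(bigA_distr_big_dep (fun i (j : 'I_N.+1) => (0 < j <= n i)%N) (fun _ _ => 1%N)).
apply: eq_bigr => i _.
have nN : (n i <= N)%N by rewrite /N (bigD1 i)//= leq_addr.
have count m : (\sum_(j < m.+1 | (0 < j <= n i)%N) 1 = minn (n i) m)%N.
  elim: m => [|m IH]; first by rewrite big_mkcond big_ord_recr big_ord0/= minn0.
  rewrite big_mkcond big_ord_recr -big_mkcond/= IH.
  have [mn|nm] := ltnP m (n i).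
    by rewrite !(minn_idPr _) ?addn1// ltnW.
  by rewrite !(minn_idPl _) ?addn0// ltnW// ltnS.
by rewrite count (minn_idPl nN).
Qed.

(* With [q ^ 4 = eps], truncating at [q ^ 2 * |n|] and taking [lam = q^-1]
   leaves the rate [lam * eps / q ^ 2 = q]. *)
Lemma capV_psum_le (R : realType) (dT : measure_display) (T : measurableType dT)
  (Pf : set (probability T R)) (d : nat) (alpha K eps : R)
  (X : {ffun 'I_d -> nat} -> T -> R) (X0 : T -> R) :
  Pf !=set0 -> 1 < alpha -> measurable_fun setT X0 ->
  (forall k, @posidx d k -> measurable_fun setT (X k)) ->
  field_indep Pf X -> (forall k, @posidx d k -> ident_distr Pf (X k) X0) ->
  slE Pf X0 = 0%E -> slE Pf (fun w => - X0 w) = 0%E -> 0 <= K ->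
  (forall P, Pf P -> \int[P]_w (exp_log_weight alpha d `|X0 w|)%:E <= K%:E)%E ->
  1 < eps ->
  exists N : nat, exists D q : R, [/\ 0 <= D, 1 < q & forall n, @posidx d n ->
    (N <= lat_norm n)%N ->
    (capV Pf [set w | ((lat_norm n)%:R * eps < `|psum X n w|)%R] <=
      ((lat_norm n)%:R * tailV Pf (fun w => `|X0 w|%R) (lat_norm n)%:R
        + D * expR (- (q * ln (lat_norm n)%:R `^ alpha)))%:E)%E].
Proof.
move=> Pf0 a1 mX0 mX [e [einj epos esurj indep]] idX E0 E0' K0 ZK eps1.
have [C C0 HC] := @sqr_le_exp_log_weight R alpha d a1.
pose q := Num.sqrt (Num.sqrt eps).
have s1 : 1 < Num.sqrt eps by rewrite -[ltLHS]sqrtr1 ltr_sqrt// (lt_trans ltr01).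
have q1 : 1 < q by rewrite -[ltLHS]sqrtr1 ltr_sqrt// (lt_trans ltr01).
have q0 : 0 < q by exact: lt_trans q1.
have q4 : q ^+ 4 = eps.
  have eps0 : 0 <= eps by rewrite ltW// (lt_trans ltr01).
  by rewrite (exprM q 2 2) !sqr_sqrtr// ltW// (lt_trans ltr01).
have c1 : 1 < q ^+ 2 by rewrite exprn_egt1.
have lam0 : 0 < q^-1 by rewrite invr_gt0.
have lam1 : q^-1 < 1 by rewrite invf_lt1.
have [N HN] := @expR_truncation_le R alpha q^-1 (q ^+ 2) d a1 lam0 lam1 (ltW c1).
(* The 2 counts the two tails; the exponential bounds [kappa ^ m], using [m t^2 <= 1] and
   [m * m^-2 <= 1]. *)
exists N, (2 * expR (2 * (C + K) + K)), q; split => // n n0 Nn.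
have [] := HN _ Nn; set m := lat_norm n; set L := ln m%:R.
set y := q ^+ 2 * m%:R; set t := q^-1 * L `^ alpha / y => m0 t0 mt2 Ht.
have m0R : (0 : R) < m%:R by rewrite ltr0n.
pose kappa := 1 + (2 * t ^+ 2) * (C + K) + m%:R ^- 2 * K.
have mv0 : 0 <= m%:R ^- 2 :> R by rewrite invr_ge0 exprn_ge0.
have mgf (sigma : R) : `|sigma| = 1 ->
    (slE Pf (fun w => expR (t * Num.min (sigma * X0 w)%R y)) <= kappa%:E)%E.
  move=> s_1; apply: ge_ereal_sup => _ [P PfP <-].
  have msX : measurable_fun setT (fun w => sigma * X0 w) by exact: measurable_funM.
  have normE w : `|sigma * X0 w| = `|X0 w| by rewrite normrM s_1 mul1r.
  apply: (@integral_le_of_quadratic_bound _ _ _ P (fun w => sigma * X0 w)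
    (fun w => exp_log_weight alpha d `|X0 w|) _ C K t (2 * t ^+ 2) (m%:R ^- 2)) => //.
  - by apply: (measurableT_comp (measurable_exp_log_weight alpha d)); exact: measurableT_comp.
  - apply: (measurableT_comp (@measurable_expR R)); apply: measurable_funM => //.
    exact: measurable_minr.
  - by move=> w; exact: exp_log_weight_ge0.
  - exact: ZK.
  (* Under every [P] of the family both [X0] and [- X0] have mean at most 0, one sign from each
     centering hypothesis. *)
  - have [s0|s0] := leP 0 sigma.
      have -> : sigma = 1 by rewrite -s_1 ger0_norm.
      rewrite -E0; under eq_integral do rewrite mul1r.
      by apply: ereal_sup_ubound; exists P.
    have -> : sigma = - 1 by rewrite -s_1 ltr0_norm// opprK.
    rewrite -E0'; under eq_integral do rewrite mulN1r.
    by apply: ereal_sup_ubound; exists P.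
  - by move=> w; rewrite -normE; exact: HC.
  - exact: ltW.
  - by rewrite mulr_ge0// sqr_ge0.
  by move=> w; rewrite expR_ge0/= -normE; exact: Ht.
have [M HM] := lattice_rect_sum n einj epos esurj.
pose J := [pred i : nat | [forall j, e i j <= n j]%N].
have cardJ : #|[pred i : 'I_M | J i]| = m.
  by rewrite -sum1_card /m -lattice_rect_card; exact/esym/(HM nat (fun=> 1%N)).
have -> : [set w | m%:R * eps < `|psum X n w|] =
    [set w | m%:R * eps < `|\sum_(i < M | J i) X (e i) w|].
  by apply/seteqP; split => w /=; rewrite /psum (HM R (fun k => X k w)).
(* The gap between [m] and the truncation level [y] is the room required to compare tails of
   identically distributed variables. *)
have my : m%:R < y by rewrite /y ltr_pMl.
have idY i : ident_distr Pf (X (e i)) X0 by exact/idX/epos.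
have mY i : measurable_fun setT (X (e i)) by exact/mX/epos.
have := @capV_sum_le _ _ _ Pf (fun i => X (e i)) X0 J M (m%:R * eps) m%:R y t kappa
  Pf0 mY mX0 indep idY my (ltW t0) mgf.
rewrite cardJ => /le_trans; apply; rewrite lee_fin lerD2l -mulrA ler_wpM2l//.
have -> : t * (m%:R * eps) = q * L `^ alpha.
  rewrite /t /y -q4; field; rewrite !gt_eqF//.
rewrite mulrC ler_wpM2r ?expR_ge0//.
have kE : kappa <= expR (2 * t ^+ 2 * (C + K) + m%:R ^- 2 * K).
  by rewrite /kappa -addrA expR_ge1Dx.
have k0 : 0 <= kappa.
  have CK0 : 0 <= (2 * t ^+ 2) * (C + K) by rewrite mulr_ge0 ?addr_ge0// mulr_ge0// sqr_ge0.
  by rewrite /kappa addr_ge0 ?addr_ge0// mulr_ge0.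
apply: (@le_trans _ _ (expR (2 * t ^+ 2 * (C + K) + m%:R ^- 2 * K) ^+ m)).
  by rewrite lerXn2r ?nnegrE ?expR_ge0.
rewrite -expRM_natl ler_expR mulrDr; apply: lerD.
  rewrite mulrA ler_wpM2r ?addr_ge0// mulrCA; lra.
rewrite mulrA ler_piMl// expr2 invfM mulrA divff ?gt_eqF// mul1r.
by rewrite invf_le1// ler1n.
Qed.

(** * Summing the tail bound over the lattice *)

Theorem theorem5p1 (R : realType) (dT : measure_display) (T : measurableType dT)
  (Pf : set (probability T R)) (H : set (T -> R))
  (d : nat) (alpha : R) (X : {ffun 'I_d -> nat} -> T -> R) (X0 : T -> R) :
  sl_space Pf H ->
  (2 <= d)%N -> 1 < alpha ->
  H X0 -> (forall k, @posidx d k -> H (X k)) ->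
  field_indep Pf X ->
  (forall k, @posidx d k -> ident_distr Pf (X k) X0) ->
  slE Pf X0 = 0%E -> slE Pf (fun w => - X0 w) = 0%E ->
  (choquetV Pf (fun w => (expR (logp `|X0 w| `^ alpha) * (logp `|X0 w|) ^+ (d.-1))%R)
     < +oo)%E ->
  forall eps : R, 1 < eps ->
    (\esum_(n in @posidx d)
       ((expR (ln (lat_norm n)%:R `^ alpha) * ln (lat_norm n)%:R `^ (alpha - 1)
          / ((lat_norm n)%:R ^+ 2))%:E
        * capV Pf [set w | ((lat_norm n)%:R * eps < `|psum X n w|)%R]) < +oo)%E.
Proof.
move=> [Pf0 Hmeas _ _] d2 a1 HX0 HX indX idX E0 E0' choq eps eps1.
have d0 : (0 < d)%N by exact: leq_trans d2.
have a0 : 0 < alpha by exact: lt_trans a1.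
have mX0 := Hmeas _ HX0.
have mX k : @posidx d k -> measurable_fun setT (X k) by move=> /HX/Hmeas.
have mnX0 : measurable_fun setT (fun w => `|X0 w|) by exact: measurableT_comp.
pose Z w := exp_log_weight alpha d `|X0 w|.
have mZ : measurable_fun setT Z by exact: measurableT_comp (measurable_exp_log_weight _ _) mnX0.
have Z0 w : 0 <= Z w by exact: exp_log_weight_ge0.
have choq_ge0 : (0 <= choquetV Pf Z)%E.
  by rewrite choquetV_ge0E//; apply: integral_ge0 => x _; rewrite lee_fin tailV_ge0.
pose K := fine (choquetV Pf Z).
have KE : choquetV Pf Z = K%:E by rewrite fineK// ge0_fin_numE.
have K0 : 0 <= K by rewrite fine_ge0.
have ZK P : Pf P -> (\int[P]_w (exp_log_weight alpha d `|X0 w|)%:E <= K%:E)%E.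
  by move=> PfP; rewrite -KE; exact: integral_le_choquetV.
have [N [D [q [D0 q1 HS]]]] :=
  capV_psum_le Pf0 a1 mX0 mX indX idX E0 E0' K0 ZK eps1.
pose u (m : nat) : R := exp_lnpow alpha m * ln m%:R `^ (alpha - 1).
have u0 m : 0 <= u m by rewrite mulr_ge0 ?expR_ge0 ?powR_ge0.
(* The product is [(ln m) ^ (alpha - 1) * exp (- (q - 1) (ln m) ^ alpha)], bounded because [q > 1];
   the first factor is the power [(alpha - 1) / alpha] of [(ln m) ^ alpha]. *)
have [C3 C31 HC3] : exists2 C3, 1 <= C3 & forall m : nat,
    u m * expR (- (q * ln m%:R `^ alpha)) <= C3 :> R.
  have b0 : 0 < (alpha - 1) / alpha by rewrite divr_gt0// subr_gt0.
  have q10 : 0 < q - 1 by rewrite subr_gt0.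
  have [C3 C31 HC3] := powR_le_expR b0 q10; exists C3 => // m.
  have := HC3 _ (powR_ge0 (ln m%:R) alpha).
  rewrite -powRrM (mulrC alpha) divfK ?gt_eqF// => Hm.
  rewrite /u /exp_lnpow mulrAC -expRD.
  set l := ln m%:R `^ alpha in Hm *.
  have -> : l + - (q * l) = - ((q - 1) * l) by ring.
  by rewrite expRN mulrC ler_pdivrMr ?expR_gt0.
(* [W] dominates [u m] for the norms below [N], where the capacity is only bounded by 1. *)
pose W := \sum_(m < N) u m.
pose C1 := W + D * C3.
have W0 : 0 <= W by rewrite sumr_ge0.
have DC0 : 0 <= D * C3 by rewrite mulr_ge0// (le_trans ler01).
pose h (x : nat) := tailV Pf (fun w => `|X0 w|) x%:R.
have h0 m : 0 <= h m by exact: tailV_ge0.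
have hS m : h m.+1 <= h m.
  by apply: tailV_le => // w; apply: lt_trans; rewrite ltr_nat.
(* Each term splits into a tail part for Abel summation and a multiple of [|n|^-2], which is
   summable. *)
have term n : @posidx d n ->
    ((expR (ln (lat_norm n)%:R `^ alpha) * ln (lat_norm n)%:R `^ (alpha - 1)
          / ((lat_norm n)%:R ^+ 2))%:E
        * capV Pf [set w | ((lat_norm n)%:R * eps < `|psum X n w|)%R] <=
     (u (lat_norm n) / (lat_norm n)%:R * h (lat_norm n) + C1 * (lat_norm n)%:R ^- 2)%:E)%E.
  move=> n0; have := lat_norm_gt0 n0; have := HS n n0.
  set A := [set w | _]; set m := lat_norm n => HSn m0.
  have m0R : (0 : R) < m%:R by rewrite ltr0n.
  rewrite -/(exp_lnpow alpha m) -/(u m).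
  have um0 : 0 <= u m / m%:R ^+ 2 by rewrite divr_ge0// exprn_ge0.
  have mA : measurable A.
    apply: measurable_setlt; apply: measurableT_comp => //.
    have -> : psum X n = fun w => \sum_(f : {ffun 'I_d -> 'I_(\sum_(i < d) n i).+1})
        (if [forall i, (0 < f i)%N && (f i <= n i)%N]
        then X [ffun i => nat_of_ord (f i)] w else 0).
      by apply/funext => w; rewrite /psum big_mkcond.
    apply: measurable_sum => f; case: (boolP [forall i, _]) => // /forallP f0.
    by apply: mX => i; rewrite ffunE; case/andP: (f0 i).
  have [mN|Nm] := ltnP m N.
    apply: (@le_trans _ _ (u m / m%:R ^+ 2)%:E).
      by rewrite -[leRHS]mule1 lee_wpmul2l ?lee_fin// capV_le1.
    rewrite lee_fin; apply: ler_wpDl; first by rewrite mulr_ge0 ?h0// divr_ge0.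
    apply: ler_wpM2r; first by rewrite invr_ge0 exprn_ge0.
    by rewrite /C1 ler_wpDr// /W (bigD1 (Ordinal mN))//= ler_wpDr// sumr_ge0.
  apply: (@le_trans _ _ ((u m / m%:R ^+ 2)%:E *
      (m%:R * h m + D * expR (- (q * ln m%:R `^ alpha)))%:E)%E).
    by rewrite lee_wpmul2l ?lee_fin// HSn.
  rewrite -EFinM lee_fin mulrDr; apply: lerD.
    have -> : u m / m%:R ^+ 2 * (m%:R * h m) = u m / m%:R * h m.
      by field; rewrite gt_eqF.
    by [].
  rewrite mulrAC ler_wpM2r ?invr_ge0 ?exprn_ge0// mulrCA.
  by rewrite /C1 ler_wpDl// ler_wpM2l.
have [C4 C40 HC4] := @sum_lattice_monotone_le R alpha d a1 d0.
apply: (@le_lt_trans _ _ (C4 * (h 0%N + K) + C1 * 2 ^+ d)%:E); last exact: ltry.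
apply: esum_posidx_le => [n n0|M].
  by rewrite mule_ge0 ?capV_ge0// lee_fin !mulr_ge0 ?expR_ge0 ?powR_ge0// invr_ge0 exprn_ge0.
apply: le_trans (lee_sum _ (fun g _ => term _ (posidx_box_pt g))) _.
rewrite sumEFin lee_fin big_split/= -mulr_sumr; apply: lerD; last first.
  by rewrite ler_wpM2l ?addr_ge0// sum_lat_norm_inv_sqr.
have [N' HN'] := HC4 h M h0 hS.
apply: le_trans HN' _; rewrite ler_wpM2l// lerD2l.
pose phi m : R := exp_log_weight alpha d m%:R.
have phiS m : phi m <= phi m.+1.
  by apply: ler_exp_log_weight; rewrite ?ler_nat// ltW.
(* The event [|X0| > m + 1] lies in [Z > phi (m + 1)], so the sum becomes a lower Riemann sum for
   the Choquet integral of [Z]. *)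
apply: (@le_trans _ _ (\sum_(m < N') (phi m.+1 - phi m) * tailV Pf Z (phi m.+1))).
  apply: ler_sum => m _; rewrite ler_wpM2l ?subr_ge0 ?phiS//.
  apply: tailV_le => // w mX0w; apply: exp_log_weight_lt => //; exact: ler1n.
rewrite -lee_fin -KE choquetV_ge0E//.
apply: sum_increment_le_integral => //.
- by move=> x; exact: tailV_ge0.
- by move=> x y xy; apply: tailV_le => // w; exact: le_lt_trans.
- exact: exp_log_weight_ge0.
Qed.
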